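(* Let $K$ be an infinite field, and let $\mathbb{X}\subseteq\mathbb{P}^n_K$ be a $0$-dimensional locally Gorenstein scheme with no point of $\mathrm{Supp}(\mathbb{X})$ on the hyperplane $X_0=0$. Let $\Delta_{\mathbb{X}}=\deg(\mathbb{X})-\mathrm{HF}_{\mathbb{X}}(r_{\mathbb{X}}-1)$. (a) If $r_{\mathbb{X}}=1$, then $\mathbb{X}$ is an almost Gorenstein level scheme. (b) If $r_{\mathbb{X}}=1$ and $\deg(\mathbb{X})>2$, then $\mathbb{X}$ has minimal Dedekind different. (c) If $\mathbb{X}$ is level and $\min\{\Delta_{\mathbb{X}},r_{\mathbb{X}}\}\ge2$, then $\mathbb{X}$ is not an almost Gorenstein scheme.
   Context: Setting. $P=K[X_0,\dots,X_n]$ has the standard grading, $I_{\mathbb{X}}\subseteq P$ is the (saturated) homogeneous vanishing ideal of $\mathbb{X}$, $R=P/I_{\mathbb{X}}$ with homogeneous maximal ideal $\mathfrak{m}$, and $\mathrm{Supp}(\mathbb{X})=\{p_1,\dots,p_s\}$ is the set of closed points. The residue class $x_0$ of $X_0$ in $R$ is a non-zerodivisor. $\mathcal{O}_{\mathbb{X},p_j}$ is the local ring at $p_j$; $\deg(\mathbb{X})=\sum_j\dim_K\mathcal{O}_{\mathbb{X},p_j}$. $\mathrm{HF}_{\mathbb{X}}(i)=\dim_KR_i$, and $r_{\mathbb{X}}$ is the least integer such that $\mathrm{HF}_{\mathbb{X}}(i)=\deg(\mathbb{X})$ for all $i\ge r_{\mathbb{X}}$. $\mathbb{X}$ is locally Gorenstein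 if every $\mathcal{O}_{\mathbb{X},p_j}$ is a Gorenstein ring. $\mathbb{X}$ is level if the socle of the Artinian local ring $\overline R=R/\langle x_0\rangle$ (the annihilator of its maximal ideal) equals $\overline R_{r_{\mathbb{X}}}$. Complementary module and different. $Q^h(R)=R_{x_0}$ is the localization of $R$ at all homogeneous non-zerodivisors and $L_0=K[x_0,x_0^{-1}]$. Fix a homogeneous trace map $\sigma$ of degree zero of $Q^h(R)/L_0$, i.e. a homogeneous element of degree $0$ of the graded module $\underline{\mathrm{Hom}}_{L_0}(Q^h(R),L_0)$ which is a $Q^h(R)$-basis of it; it exists when $\mathbb{X}$ is locally Gorenstein. The Dedekind complementary module $\mathfrak{C}^\sigma_{\mathbb{X}}\subseteq Q^h(R)$ is the image of the injection $\underline{\mathrm{Hom}}_{K[x_0]}(R,K[x_0])\to\underline{\mathrm{Hom}}_{L_0}(Q^h(R),L_0)=Q^h(R)\sigma\cong Q^h(R)$, $\varphi\mapsto\varphi\otimes\mathrm{id}_{L_0}$ (the last isomorphism sending $g\sigma$ to $g$). The Dedekind different is $\delta^\sigma_{\mathbb{X}}=\{f\in Q^h(R)\mid f\cdot\mathfrak{C}^\sigma_{\mathbb{X}}\subseteq R\}$, a homogeneous ideal of $R$. $\mathbb{X}$ has minimal Dedekind different if $\delta^\sigma_{\mathbb{X}}=\bigoplus_{i\ge2r_{\mathbb{X}}}R_i$. $\mathbb{X}$ is almost Gorenstein if there is an exact sequence of graded $R$-modules $0\to R\to\mathfrak{C}^\sigma_{\mathbb{X}}(-r_{\mathbb{X}})\to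 C\to0$ (degree-zero maps) with $\mathfrak{m}\cdot C=\langle0\rangle$. *)

(* Defs.v *)
From HB Require Import structures.
From mathcomp Require Import all_boot all_order all_algebra.
From mathcomp Require Import generic_quotient ring_quotient ring.
From mathcomp Require Import boolp classical_sets functions cardinality fsbigop.
From mathcomp Require Import mpoly.

Set Implicit Arguments.
Unset Strict Implicit.
Unset Printing Implicit Defensive.

Import Order.TTheory GRing.Theory Num.Theory.

Local Open Scope ring_scope.
Local Open Scope classical_set_scope.
Local Open Scope quotient_scope.

(* The localization S^-1 A of a commutative ring A at a multiplicatively      *)
(* closed subset S, as the quotient of A * S by                               *)
(*   (a, s) ~ (b, t)  iff  u (a t) = u (b s) for some u in S.                 *)
Module Localization.
Section Localization.
Variables (A : comPzRingType) (S : mulrClosed A).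

Definition den := {s : A | s \in S}.
#[export] HB.instance Definition _ := Choice.on den.

Definition one_den : den := exist _ 1 (@rpred1 _ S).
Definition mul_den (s t : den) : den :=
  exist _ (val s * val t) (rpredM (valP s) (valP t)).

Lemma val_one_den : val one_den = 1. Proof. by []. Qed.
Lemma val_mul_den s t : val (mul_den s t) = val s * val t. Proof. by []. Qed.
Let denE := (val_one_den, val_mul_den).

Definition equiv (x y : A * den) : bool :=
  `[< exists u : den, val u * (x.1 * val y.2) = val u * (y.1 * val x.2) >].

Lemma equiv_is_equiv : equiv_class_of equiv.
Proof.
have sym x y : equiv x y -> equiv y x.
  by move=> /asboolP[u Hu]; apply/asboolP; exists u.
split=> [x|x y|y x z].
- by apply/asboolP; exists one_den.
- by apply/idP/idP; apply: sym.
- move=> /asboolP[u Hu] /asboolP[v Hv]; apply/asboolP.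
  exists (mul_den (mul_den u v) y.2); rewrite !denE.
  transitivity (val v * val z.2 * (val u * (x.1 * val y.2))); first by ring.
  rewrite Hu.
  transitivity (val u * val x.2 * (val v * (y.1 * val z.2))); first by ring.
  by rewrite Hv; ring.
Qed.

Canonical equiv_equiv := EquivRelPack equiv_is_equiv.
Canonical equiv_encModRel := defaultEncModRel equiv.

Definition type := {eq_quot equiv}.
#[export] HB.instance Definition _ : EqQuotient _ equiv type := EqQuotient.on type.
#[export] HB.instance Definition _ := Choice.on type.

Definition frac (a : A) (s : den) : type := \pi_type (a, s).

Lemma eq_fracP a s b t :
  frac a s = frac b t <->
  exists u : den, val u * (a * val t) = val u * (b * val s).
Proof.
rewrite /frac; split => [/eqmodP/asboolP //|H].
by apply/eqmodP/asboolP.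
Qed.

Lemma fracW (P : type -> Prop) : (forall a s, P (frac a s)) -> forall x, P x.
Proof. by move=> H x; rewrite -[x]reprK; case: (repr x) => a s; apply: H. Qed.

Definition add (x y : type) : type :=
  let: (a, s) := repr x in let: (b, t) := repr y in
  frac (a * val t + b * val s) (mul_den s t).
Definition mul (x y : type) : type :=
  let: (a, s) := repr x in let: (b, t) := repr y in
  frac (a * b) (mul_den s t).
Definition opp (x : type) : type := let: (a, s) := repr x in frac (- a) s.

Lemma repr_frac a s : exists u : den,
  val u * ((repr (frac a s)).1 * val s) = val u * (a * val (repr (frac a s)).2).
Proof.
by apply/eq_fracP; rewrite -[RHS]reprK; case: (repr (frac a s)).
Qed.

Lemma addE a s b t :
  add (frac a s) (frac b t) = frac (a * val t + b * val s) (mul_den s t).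
Proof.
rewrite /add; have [u] := repr_frac a s; have [v] := repr_frac b t.
case: (repr (frac a s)) => a' s'; case: (repr (frac b t)) => b' t'; rewrite [_.1]/= [_.2]/= => Hv Hu.
apply/eq_fracP; exists (mul_den u v); rewrite !denE.
transitivity ((val u * (a' * val s)) * (val v * val t' * val t)
  + (val v * (b' * val t)) * (val u * val s' * val s)); first by ring.
by rewrite Hu Hv; ring.
Qed.

Lemma mulE a s b t : mul (frac a s) (frac b t) = frac (a * b) (mul_den s t).
Proof.
rewrite /mul; have [u] := repr_frac a s; have [v] := repr_frac b t.
case: (repr (frac a s)) => a' s'; case: (repr (frac b t)) => b' t'; rewrite [_.1]/= [_.2]/= => Hv Hu.
apply/eq_fracP; exists (mul_den u v); rewrite !denE.
transitivity ((val u * (a' * val s)) * (val v * (b' * val t))); first by ring.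
by rewrite Hu Hv; ring.
Qed.

Lemma oppE a s : opp (frac a s) = frac (- a) s.
Proof.
rewrite /opp; have [u] := repr_frac a s.
case: (repr (frac a s)) => a' s'; rewrite [_.1]/= [_.2]/= => Hu.
apply/eq_fracP; exists u.
by transitivity (- (val u * (a' * val s))); [ring|rewrite Hu; ring].
Qed.

Lemma addA : associative add.
Proof.
elim/fracW=> a s; elim/fracW=> b t; elim/fracW=> c u.
by rewrite !addE; apply/eq_fracP; exists one_den; rewrite !denE; ring.
Qed.

Lemma addC : commutative add.
Proof.
elim/fracW=> a s; elim/fracW=> b t.
by rewrite !addE; apply/eq_fracP; exists one_den; rewrite !denE; ring.
Qed.

Lemma add0 : left_id (frac 0 one_den) add.
Proof.
elim/fracW=> a s.
by rewrite !addE; apply/eq_fracP; exists one_den; rewrite !denE; ring.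
Qed.

Lemma addN : left_inverse (frac 0 one_den) opp add.
Proof.
elim/fracW=> a s.
by rewrite oppE !addE; apply/eq_fracP; exists one_den; rewrite !denE; ring.
Qed.

Lemma mulA : associative mul.
Proof.
elim/fracW=> a s; elim/fracW=> b t; elim/fracW=> c u.
by rewrite !mulE; apply/eq_fracP; exists one_den; rewrite !denE; ring.
Qed.

Lemma mulC : commutative mul.
Proof.
elim/fracW=> a s; elim/fracW=> b t.
by rewrite !mulE; apply/eq_fracP; exists one_den; rewrite !denE; ring.
Qed.

Lemma mul1 : left_id (frac 1 one_den) mul.
Proof.
elim/fracW=> a s.
by rewrite !mulE; apply/eq_fracP; exists one_den; rewrite !denE; ring.
Qed.

Lemma mulDl : left_distributive mul add.
Proof.
elim/fracW=> a s; elim/fracW=> b t; elim/fracW=> c u.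
by rewrite !(mulE, addE); apply/eq_fracP; exists one_den; rewrite !denE; ring.
Qed.

#[export] HB.instance Definition _ := GRing.isZmodule.Build type addA addC add0 addN.
#[export] HB.instance Definition _ :=
  GRing.Zmodule_isComPzRing.Build type mulA mulC mul1 mulDl.

Lemma fracD a s b t :
  frac a s + frac b t = frac (a * val t + b * val s) (mul_den s t).
Proof. exact: addE. Qed.
Lemma fracN a s : - frac a s = frac (- a) s.
Proof. exact: oppE. Qed.
Lemma fracM a s b t : frac a s * frac b t = frac (a * b) (mul_den s t).
Proof. exact: mulE. Qed.
Lemma frac1 : 1 = frac 1 one_den.
Proof. by []. Qed.
Lemma frac0 : 0 = frac 0 one_den.
Proof. by []. Qed.

End Localization.

Module Exports. HB.reexport. End Exports.
End Localization.
Export Localization.Exports.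

Notation localization S := (@Localization.type _ S).
Notation frac := (@Localization.frac _ _).

Section HomogeneousElements.
Variables (V : zmodType) (V_ : int -> set V).

(* u is a family of homogeneous components of x: x = \sum_i u i, u i \in V_i, *)
(* with u i = 0 for all but finitely many i.                                  *)
Definition homog_decomposition (x : V) (u : int -> V) : Prop :=
  (forall i, V_ i (u i)) /\
  exists s : seq int,
    [/\ uniq s, forall i, i \notin s -> u i = 0 & x = \sum_(i <- s) u i].

(* The elements of \bigoplus_(i >= a) V_i. *)
Definition degree_ge (a : int) : set V :=
  [set x | exists2 u, homog_decomposition x u & forall i, i < a -> u i = 0].

End HomogeneousElements.

Section GradedHom.
Variables (A : comPzRingType) (A_ : int -> set A) (B : set A).

(* B-linear maps A -> B, homogeneous of degree d, where B is a graded subring *)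
(* of A (so that B_i = B `&` A_i); maps with values in B are represented as   *)
(* maps A -> A.                                                               *)
Definition homog_hom (d : int) (phi : A -> A) : Prop :=
  [/\ forall b, B b -> forall f g, phi (b * f + g) = b * phi f + phi g,
      forall f, B (phi f)
    & forall i f, A_ i f -> A_ (i + d) (phi f)].

(* The graded module \underline{Hom}_B(A, B) of finite sums of such maps. *)
Definition graded_hom (phi : A -> A) : Prop :=
  exists u : int -> A -> A, (forall d, homog_hom d (u d)) /\
    exists s : seq int, forall f, phi f = \sum_(d <- s) u d f.

End GradedHom.

(* The dimension over K of a K-subspace V of a K-algebra A with structure map *)
(* e : K -> A; it is set to 0 if V has no finite basis.                       *)
Section Dimension.
Variables (K : fieldType) (A : comPzRingType) (e : K -> A).

Definition has_dim (V : set A) (d : nat) : Prop :=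
  exists2 b : 'I_d -> A, (forall i, V (b i)) &
    forall x, V x -> exists! c : 'rV[K]_d, x = \sum_i e (c 0 i) * b i.

Definition dimK (V : set A) : nat := xget 0%N (has_dim V).

End Dimension.

Section Gorenstein.
Variable A : comPzRingType.

Definition injective_module (E : lmodType A) : Prop :=
  forall (M N : lmodType A) (i : {linear M -> N}) (f : {linear M -> E}),
    injective i -> exists g : {linear N -> E}, forall x, g (i x) = f x.

Fixpoint injdim_le (d : nat) (M : lmodType A) : Prop :=
  if d is d'.+1 then
    exists (E C : lmodType A) (i : {linear M -> E}) (q : {linear E -> C}),
      [/\ injective_module E, injective i,
          forall x, q x = 0 <-> exists y, x = i y,
          forall c, exists x, q x = c
        & injdim_le d' C]
  else injective_module M.

(* For a Noetherian local ring A: A has finite injective dimension as an      *)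
(* A-module. It is only used for the local rings of a scheme.                 *)
Definition gorenstein_local : Prop := exists d, injdim_le d A^o.

End Gorenstein.


(* Z-graded commutative K-algebras, with structure map ga_scalar; every       *)
(* element is uniquely a finite sum of homogeneous elements.                  *)
Record graded_algebra (K : fieldType) := GradedAlgebra {
  ga_ring :> comNzRingType;
  ga_scalar : {rmorphism K -> ga_ring};
  ga_deg : int -> set ga_ring;
  ga_deg_scalar : forall c, ga_deg 0 (ga_scalar c);
  ga_degB : forall i f g, ga_deg i f -> ga_deg i g -> ga_deg i (f - g);
  ga_degM : forall i j f g,
    ga_deg i f -> ga_deg j g -> ga_deg (i + j) (f * g);
  ga_decomposition : forall f, exists! u, homog_decomposition ga_deg f u }.

Arguments ga_scalar {K}.
Arguments ga_deg {K}.

Section GradedAlgebraTheory.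
Variables (K : fieldType) (R : graded_algebra K).
Local Notation R_ := (ga_deg R).

Lemma ga_deg0 i : R_ i 0.
Proof.
have [u [[Ru [s [_ _ _]]] _]] := ga_decomposition (0 : R).
by rewrite -(subrr (u i)); exact: ga_degB.
Qed.

Lemma ga_degN i f : R_ i f -> R_ i (- f).
Proof. by rewrite -[- f]add0r; apply: ga_degB; exact: ga_deg0. Qed.

Lemma ga_degD i f g : R_ i f -> R_ i g -> R_ i (f + g).
Proof. by move=> fi gi; rewrite -[g]opprK; apply/ga_degB/ga_degN. Qed.

Lemma ga_deg1 : R_ 0 1.
Proof. by rewrite -(rmorph1 (ga_scalar R)); exact: ga_deg_scalar. Qed.

End GradedAlgebraTheory.

Definition graded_module (K : fieldType) (R : graded_algebra K)
    (M : lmodType R) (M_ : int -> set M) : Prop :=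
  [/\ forall i j f x, ga_deg R i f -> M_ j x -> M_ (i + j) (f *: x),
      forall i x y, M_ i x -> M_ i y -> M_ i (x - y)
    & forall x, exists! u, homog_decomposition M_ x u].

Section Proj.
Variables (K : fieldType) (R : graded_algebra K).
Local Notation R_ := (ga_deg R).

(* The ideal of R generated by the homogeneous elements of positive degree,   *)
(* for R concentrated in nonnegative degrees.                                 *)
Definition irrelevant_ideal : set R := degree_ge R_ 1.

Definition proj_point (p : set R) : Prop :=
  [/\ idealr_closed [pred f | f \in p],
      prime_idealr_closed [pred f | f \in p],
      forall f, p f -> exists2 u, homog_decomposition R_ f u & forall i, p (u i)
    & ~ (irrelevant_ideal `<=` p)].

Definition Proj : set (set R) := [set p | proj_point p].

(* Proj R is nonempty and its points have no proper specializations.          *)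
Definition zero_dimensional : Prop :=
  (exists p, Proj p) /\ forall p q, Proj p -> Proj q -> p `<=` q -> p = q.

(* The local ring of Proj R at a point p: the degree 0 part of the            *)
(* localization of R at the homogeneous elements outside p.                   *)
Section LocalRing.
Variable p : Proj.

Definition homog_compl : pred R :=
  fun f => `[< (exists i, R_ i f) /\ ~ val p f >].

Lemma homog_compl_mulr_closed : GRing.mulr_closed homog_compl.
Proof.
have [[_ /= p1 _] pM _ _] : proj_point (val p) by have := valP p; rewrite inE.
split=> [|f g]; rewrite ?unfold_in.
- apply/asboolP; split; first by exists 0; exact: ga_deg1.
  by move=> ?; case/negP: p1; rewrite !inE.
- move=> /asboolP[[i fi] pf] /asboolP[[j gj] pg]; apply/asboolP; split.
    by exists (i + j); exact: ga_degM.
  move=> pfg; have := pM f g; rewrite /= !inE => /(_ pfg)/orP.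
  by rewrite !inE => -[].
Qed.

HB.instance Definition _ := GRing.isMulClosed.Build R homog_compl
  homog_compl_mulr_closed.

Definition homog_localization :=
  localization (GRing.MulClosed.clone R homog_compl _).
HB.instance Definition _ := GRing.ComPzRing.on homog_localization.

Definition local_ring_pred : pred homog_localization :=
  fun q => `[< exists i f s, [/\ R_ i f, R_ i (val s) & q = frac f s] >].

Lemma local_ring_subring_closed : subring_closed local_ring_pred.
Proof.
split; rewrite ?unfold_in.
- apply/asboolP; exists 0, 1, (Localization.one_den _).
  by split => //; exact: ga_deg1.
- move=> q q'; rewrite !unfold_in.
  move=> /asboolP[i [f [s [fi si ->]]]] /asboolP[j [g [t [gj tj ->]]]].
  apply/asboolP; exists (i + j); rewrite Localization.fracN Localization.fracD.
  do 2 eexists; split; last by [].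
    apply: ga_degD; first exact: ga_degM.
    by rewrite addrC; apply: ga_degM => //; exact: ga_degN.
  exact: ga_degM.
- move=> q q'; rewrite !unfold_in.
  move=> /asboolP[i [f [s [fi si ->]]]] /asboolP[j [g [t [gj tj ->]]]].
  apply/asboolP; exists (i + j); rewrite Localization.fracM.
  by do 2 eexists; split; last by []; exact: ga_degM.
Qed.

Definition local_ring := {q : homog_localization | local_ring_pred q}.
HB.instance Definition _ := SubType.on local_ring.
HB.instance Definition _ := Choice.on local_ring.
HB.instance Definition _ := 
  GRing.SubChoice_isSubComPzRing.Build homog_localization local_ring_pred
    local_ring local_ring_subring_closed.

Definition local_degree : nat :=
  dimK (fun c => frac (ga_scalar R c) (Localization.one_den _))
       [set q | local_ring_pred q].

End LocalRing.

Definition locally_gorenstein : Prop :=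
  forall p : Proj, gorenstein_local (local_ring p).

(* The sum of the dimensions of the local rings (for finite Proj R).          *)
Definition proj_degree : nat := \sum_(p \in [set: Proj]) local_degree p.

Definition HF (i : int) : nat := dimK (ga_scalar R) (R_ i).

Definition is_regularity_index (r : int) : Prop :=
  (forall i, r <= i -> HF i = proj_degree) /\
  forall r', (forall i, r' <= i -> HF i = proj_degree) -> r <= r'.

(* Set to 0 if there is no such integer.                                      *)
Definition regularity_index : int := xget 0 is_regularity_index.

Definition Delta : int := proj_degree%:Z - (HF (regularity_index - 1))%:Z.

End Proj.

Arguments irrelevant_ideal {K} R.
Arguments Proj {K} R.
Arguments zero_dimensional {K} R.
Arguments locally_gorenstein {K} R.
Arguments proj_degree {K} R.
Arguments HF {K} R i.
Arguments regularity_index {K} R.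
Arguments Delta {K} R.

Section Different.
Variables (K : fieldType) (R : graded_algebra K) (x0 : R).
Local Notation R_ := (ga_deg R).
Local Notation r := (regularity_index R).

Definition powers : pred R := fun f => `[< exists k : nat, f = x0 ^+ k >].

Lemma powers_mulr_closed : GRing.mulr_closed powers.
Proof.
split=> [|f g]; rewrite ?unfold_in; first by apply/asboolP; exists 0%N.
move=> /asboolP[k ->] /asboolP[l ->]; apply/asboolP.
by exists (k + l)%N; rewrite exprD.
Qed.

HB.instance Definition _ := GRing.isMulClosed.Build R powers powers_mulr_closed.

Lemma powersX k : x0 ^+ k \in powers.
Proof. by apply/asboolP; exists k. Qed.

(* Q^h(R) = R_{x_0}, for x_0 of degree 1.                                     *)
Definition Qh := localization (GRing.MulClosed.clone R powers _).
HB.instance Definition _ := GRing.ComPzRing.on Qh.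

(* f / x_0^k *)
Definition Qfrac (f : R) (k : nat) : Qh :=
  frac f (exist (fun s => s \in powers) (x0 ^+ k) (powersX k)).

Definition Qinj (f : R) : Qh := Qfrac f 0.

Definition Qh_deg (i : int) : set Qh :=
  [set q | exists f (k : nat), R_ (i + k%:Z) f /\ q = Qfrac f k].

(* The subrings K[x_0] of R and L_0 = K[x_0, x_0^-1] of Q^h(R). *)
Definition Kx0 : set R :=
  [set f | exists a : {poly K}, f = (map_poly (ga_scalar R) a).[x0]].

Definition L0 : set Qh := [set q | exists f k, Kx0 f /\ q = Qfrac f k].

(* Homogeneous trace maps of degree zero of Q^h(R) / L_0. *)
Definition trace_map (sigma : Qh -> Qh) : Prop :=
  homog_hom Qh_deg L0 0 sigma /\
  forall psi, graded_hom Qh_deg L0 psi ->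
    exists! g, forall q, psi q = sigma (g * q).

Variable sigma : Qh -> Qh.

(* The g in Q^h(R) with g sigma = phi \otimes id_{L_0} for some phi in        *)
(* \underline{Hom}_{K[x_0]}(R, K[x_0]).                                       *)
Definition complementary_module : set Qh :=
  [set g | exists2 phi, graded_hom R_ Kx0 phi &
     forall f k, sigma (g * Qfrac f k) = Qfrac (phi f) k].

Local Notation CX := complementary_module.

Definition dedekind_different : set Qh :=
  [set f | forall g, CX g -> exists h, f * g = Qinj h].

Definition minimal_dedekind_different : Prop :=
  dedekind_different = [set Qinj f | f in degree_ge R_ (2 * r)].

(* alpha and beta are degree-zero R-linear maps forming an exact sequence     *)
(*   0 -> R -> CX(- r) -> C -> 0                                              *)
(* with CX(- r)_i = CX `&` Qh_deg (i - r); beta is only relevant on CX.       *)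
Definition almost_gorenstein : Prop :=
  exists (C : lmodType R) (C_ : int -> set C) (alpha : R -> Qh) (beta : Qh -> C),
    [/\ graded_module C_,
        [/\ forall a f g, alpha (a * f + g) = Qinj a * alpha f + alpha g,
            forall f, CX (alpha f)
          & forall i f, R_ i f -> Qh_deg (i - r) (alpha f)],
        (forall a g h, CX g -> CX h ->
           beta (Qinj a * g + h) = a *: beta g + beta h) /\
        (forall (i : int) g, CX g -> Qh_deg (i - r) g -> C_ i (beta g)),
        [/\ injective alpha,
            forall g, CX g -> (beta g = 0 <-> exists f, g = alpha f)
          & forall c, exists2 g, CX g & beta g = c]
      & forall a (c : C), irrelevant_ideal R a -> a *: c = 0].

End Different.

Section CoordinateRing.
Variables (K : fieldType) (n : nat).
Local Notation P := {mpoly K[n.+1]}.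

Record homog_ideal := HomogIdeal {
  hi_ideal :> idealr P;
  hi_homog : forall f d, f \in hi_ideal -> pihomog mdeg d f \in hi_ideal }.

Variable I : homog_ideal.
Local Notation R := {ideal_quot I}.

Definition coord_deg (i : int) : set R :=
  if i is Posz d then [set \pi_R p | p in [set p : P | p \is d.-homog]]
  else [set 0].

Definition coord_scalar (c : K) : R := \pi_R (c%:MP).

Lemma coord_scalar_zmod_morphism : zmod_morphism coord_scalar.
Proof. by move=> c d; rewrite /coord_scalar mpolyCB rmorphB. Qed.
Lemma coord_scalar_monoid_morphism : monoid_morphism coord_scalar.
Proof.
by split=> [|c d]; rewrite /coord_scalar ?rmorph1 // mpolyCM rmorphM.
Qed.
HB.instance Definition _ := GRing.isZmodMorphism.Build K R coord_scalar
  coord_scalar_zmod_morphism.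
HB.instance Definition _ := GRing.isMonoidMorphism.Build K R coord_scalar
  coord_scalar_monoid_morphism.

Lemma coord_deg_scalar c : coord_deg 0 (coord_scalar c).
Proof. by exists c%:MP => //; rewrite /= -[c%:MP]mulr1 mul_mpolyC; exact/dhomogZ/dhomog1. Qed.

Lemma coord_degP i f : coord_deg i f <->
  exists2 p : P, f = \pi_R p & if i is Posz d then p \is d.-homog else p = 0.
Proof.
case: i => [d|d] /=; split.
- by case=> p hp <-; exists p.
- by case=> p -> hp; exists p.
- by move=> ->; exists 0; rewrite ?rmorph0.
- by case=> p -> ->; rewrite rmorph0.
Qed.

Lemma coord_degB i f g : coord_deg i f -> coord_deg i g -> coord_deg i (f - g).
Proof.
move=> /coord_degP[p -> hp] /coord_degP[q -> hq]; apply/coord_degP.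
exists (p - q); first by rewrite rmorphB.
by case: i hp hq => [d|d] => [hp hq|-> ->]; [exact: rpredB|exact: subr0].
Qed.

Lemma coord_degM i j f g :
  coord_deg i f -> coord_deg j g -> coord_deg (i + j) (f * g).
Proof.
have deg0 k : coord_deg k 0.
  by apply/coord_degP; exists 0; [rewrite rmorph0|case: k => // d; exact: dhomog0].
case: i => [d|d]; last by move=> -> _; rewrite mul0r.
case: j => [e|e]; last by move=> _ ->; rewrite mulr0.
case=> p hp <- [q hq <-]; rewrite -PoszD; exists (p * q); last by rewrite rmorphM.
exact: dhomogM.
Qed.

Lemma coord_pihomog p q d :
  \pi_R p = \pi_R q -> \pi_R (pihomog mdeg d p) = \pi_R (pihomog mdeg d q).
Proof.
move/eqP; rewrite -Quotient.idealrBE => Ipq; apply/eqP.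
by rewrite -Quotient.idealrBE -pihomogB; exact: hi_homog.
Qed.

Lemma coord_decomposition f : exists! u, homog_decomposition coord_deg f u.
Proof.
rewrite -[f]reprK; move: (repr f) => p {f}.
pose c (i : int) : R :=
  if i is Posz d then \pi_R (pihomog mdeg d p) else 0.
exists c; split.
- split.
    case=> [d|d] //=; exists (pihomog mdeg d p) => //; exact: pihomogP.
  exists [seq Posz d | d <- iota 0 (mmeasure mdeg p)]; split.
  + by rewrite map_inj_uniq ?iota_uniq // => ? ? [].
  + case=> [d|d] // hd; rewrite /c (_ : pihomog _ _ _ = 0) ?rmorph0 //.
    have {}hd : (mmeasure mdeg p <= d)%N.
      rewrite leqNgt; apply: contra hd => hd.
      by apply/mapP; exists d; rewrite // mem_iota.
    rewrite pihomogE big_seq_cond big1 // => m /andP[mp /eqP md].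
    by move: (mmeasure_mnm_lt mdeg mp); rewrite md ltnNge hd.
  + rewrite big_map [in LHS](pihomog_partitionE (leqnn (mmeasure mdeg p))).
    by rewrite rmorph_sum -(big_mkord xpredT (fun d => c (Posz d))) /index_iota subn0.
- move=> u [hu [s [us u0 pE]]].
  have /choice[q hq] : forall i, exists q : P, u i = \pi_R q /\
      if i is Posz d then q \is d.-homog else q = 0.
    by move=> i; have /coord_degP[q -> hq] := hu i; exists q.
  have pE' : \pi_R p = \pi_R (\sum_(i <- s) q i).
    by rewrite pE rmorph_sum; apply: eq_bigr => i _; rewrite (hq i).1.
  apply/funext; case=> [d|d]; last by rewrite /c (hq _).1 (hq (Negz d)).2 rmorph0.
  rewrite /c (coord_pihomog d pE').
  have -> : pihomog mdeg d (\sum_(i <- s) q i) =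
      \sum_(i <- s) if i == Posz d then q i else 0.
    rewrite linear_sum; apply: eq_bigr => i _.
    have := (hq i).2; case: i => [e he|e ->]; last by rewrite linear0.
    case: eqP => [[ed]|ed]; first by rewrite -ed; exact: pihomog_dE.
    by apply: pihomog_ne0 he; apply/eqP => ed'; apply: ed; rewrite ed'.
  have [ds|ds] := boolP (Posz d \in s).
    rewrite (bigD1_seq _ ds us) /= eqxx big1 ?addr0 ?(hq (Posz d)).1 //.
    by move=> i /negPf->.
  rewrite (u0 _ ds) big_seq big1 ?rmorph0 // => i si; case: eqP => // ie.
  by move: ds; rewrite -ie si.
Qed.

Definition coord_ring : graded_algebra K :=
  @GradedAlgebra K R coord_scalar coord_deg coord_deg_scalar coord_degB
    coord_degM coord_decomposition.

Definition coord_x0 : coord_ring := \pi_R 'X_ord0.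

End CoordinateRing.

(* A subscheme X of P^n of dimension 0, given by its saturated homogeneous    *)
(* vanishing ideal I; saturation says that f \in I as soon as                 *)
(* (X_0, ..., X_n)^d f is contained in I for some d.                          *)
Record zero_scheme (K : fieldType) (n : nat) := ZeroScheme {
  vanishing_ideal :> homog_ideal K n;
  zs_saturated : forall (f : {mpoly K[n.+1]}) d,
    (forall g : {mpoly K[n.+1]}, g \is d.-homog -> g * f \in vanishing_ideal) ->
    f \in vanishing_ideal;
  zs_dim0 : zero_dimensional (coord_ring vanishing_ideal) }.

Section Level.
Variables (K : fieldType) (n : nat) (X : zero_scheme K n).
Local Notation R := (coord_ring X).
Local Notation x0 := (coord_x0 X).

Definition x0_ideal : pred R := fun f => `[< exists g, f = g * x0 >].

Lemma x0_idealr_closed : idealr_closed x0_ideal.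
Proof.
split.
- by apply/asboolP; exists 0; rewrite mul0r.
- apply/negP => /asboolP[g]; rewrite -[g]reprK; move: (repr g) => q {g} H.
  have /(coord_pihomog 0) :
      \pi_{ideal_quot X} (1 : {mpoly K[n.+1]}) =
      \pi_{ideal_quot X} (q * 'X_ord0 : {mpoly K[n.+1]}).
    by rewrite rmorphM rmorph1.
  rewrite (pihomog_dE (dhomog1 _ mdeg)).
  rewrite [in RHS](_ : pihomog _ _ _ = 0).
    by rewrite rmorph0 rmorph1 => /eqP; rewrite oner_eq0.
  rewrite [q](pihomog_partitionE (leqnn (mmeasure mdeg q))) mulr_suml linear_sum.
  rewrite big1 // => d _; apply: (@pihomog_ne0 _ _ _ (d + 1)%N); first by rewrite addn1.
  by apply: dhomogM; [exact: pihomogP|rewrite dhomogX; apply/eqP; exact: mdeg1].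
- move=> a f g /asboolP[f' ->] /asboolP[g' ->]; apply/asboolP.
  by exists (a * f' + g'); rewrite mulrDl mulrA.
Qed.

HB.instance Definition _ := isIdealr.Build R x0_ideal x0_idealr_closed.

(* R / <x_0> *)
Local Notation Rbar := {ideal_quot (Idealr.clone R x0_ideal _)}.

Definition socle_Rbar : set Rbar :=
  [set f | forall g, irrelevant_ideal R g -> \pi_Rbar g * f = 0].

Definition level : Prop :=
  socle_Rbar = [set \pi_Rbar f | f in ga_deg R (regularity_index R)].

End Level.

(* Main.v *)
(* The form x_0 is a non-zerodivisor of R: if x_0 f = 0 with f homogeneous,   *)
(* then no point of Proj R contains Ann(f), so a power of the maximal ideal   *)
(* kills f and f = 0 by saturation. Hence R_i = x_0^(i - r) R_r for i >= r,   *)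
(* and Q^h(R) = A[x_0, x_0^-1] with A of degree 0 and dimension deg(X). The   *)
(* trace sigma is nondegenerate on A, and an element x_0^(- i) a of degree    *)
(* - i is in C_X iff sigma vanishes on a x_0^(1 - i) R_(i - 1).               *)
(* In (c), C_X contains for dimension reasons an element g of degree - r      *)
(* outside K u, where u is the image of 1. Then x_0 g = l u with l of degree  *)
(* 1, and m C_X <= R u puts the class of l in the socle, in degree 1 < r.     *)
(* If r = 1 then R = K + A x_0 + A x_0^2 + ..., so C_X is the direct sum of   *)
(* x_0^-1 ker(sigma) and of the A x_0^i for i >= 0. As K is infinite and      *)
(* ker(sigma) lies in no proper ideal of A, it contains a unit a, and         *)
(* u = x_0^-1 a makes X almost Gorenstein. In (b), f C_X <= R forces f_0 A    *)
(* and f_1 u, f_1 u' into K, for some u' of degree - 1 in C_X outside K u,    *)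
(* hence f_0 = f_1 = 0.                                                       *)

Require Import Defs.
From HB Require Import structures.
From mathcomp Require Import all_boot all_order all_algebra.
From mathcomp Require Import generic_quotient ring_quotient ring zify.
From mathcomp Require Import boolp classical_sets cardinality finmap mpoly.

Set Implicit Arguments.
Unset Strict Implicit.
Unset Printing Implicit Defensive.

Import Order.TTheory GRing.Theory Num.Theory.
Local Open Scope ring_scope.
Local Open Scope classical_set_scope.
Local Open Scope quotient_scope.

(** * Dimension of subspaces *)

(** All arguments are linear algebra inside [Qh x0], that is [A[x_0, 1/x_0]] with [A] its part of
    degree 0. By saturation [x_0] is a non-zerodivisor ([coord_x0_nonzerodivisor]), so the
    coordinate ring [R] embeds in [Qh x0]. From the regularity index on the two coincide ([Q_Qinj]),
    whence [dim A = deg X] ([has_dim_Q0]). On [A] the trace is a [K]-linear form [tau] without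
    nonzero ideal in its kernel, and lying in the complementary module amounts to vanishing
    conditions on homogeneous components ([CXP]). Counting these conditions produces elements of
    lowest degree outside a given line ([exists_CX_off_line]).

    For (c), such an element [g], compared with the image [u] of 1, yields [l] of degree 1 with
    [x_0 g = l u]; its class is a nonzero socle element in degree 1, too low for a level scheme
    ([almost_gorenstein_socle]).

    For index 1 the complementary module is explicit: zero below degree - 1, the kernel of [sigma]
    in degree - 1, everything from degree 0 on. The socle then follows from divisibility by [x_0]
    ([socle_regularity1]). Almost Gorenstein needs a unit [u] in degree - 1; since [K] is infinite,
    a subspace of [A] lying in no proper ideal contains a unit ([exists_unit]), and [ker tau] is
    such a subspace ([exists_traceless_unit]). For the different, the quotients are tested against
    1, a non-scalar of [A], [u], and a second element of degree - 1, which exists once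
    [deg X > 2]. *)

(** Among the matrices with row space inside [S], one of maximal rank exhausts [S]: a missing vector
    would raise the rank. *)
Lemma subspace_row_space (K : fieldType) d (S : set 'rV[K]_d) :
  S 0 -> (forall c x y, S x -> S y -> S (c *: x + y)) ->
  exists M : 'M[K]_d, forall v, S v <-> (v <= M)%MS.
Proof.
move=> S0 SL.
pose P k := `[< exists M : 'M[K]_d, \rank M = k /\ forall v, (v <= M)%MS -> S v >].
have P0 : exists k, P k.
  exists 0%N; apply/asboolP; exists 0; split; first exact: mxrank0.
  by move=> v; rewrite submx0 => /eqP->.
have Pd k : P k -> (k <= d)%N by move=> /asboolP[M [<- _]]; exact: rank_leq_row.
case: (ex_maxnP P0 Pd) => k /asboolP[M [Mk MS]] kmax.
exists M => v; split=> [Sv|]; last exact: MS.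
have : P (\rank (M + v)%MS).
  apply/asboolP; exists (M + v)%MS; split=> // w /sub_addsmxP[[a b] ->] /=.
  rewrite addrC [b]mx11_scalar mul_scalar_mx; apply: SL => //.
  by apply: MS; exact: submxMl.
move=> /kmax; rewrite -Mk => h; apply: submx_trans (addsmxSr M v) _.
by rewrite (geq_leqif (mxrank_leqif_sup (addsmxSl M v))) in h.
Qed.

Section Subspaces.
Variables (K : fieldType) (A : comPzRingType) (e : {rmorphism K -> A}).

Definition subspace (V : set A) : Prop :=
  V 0 /\ forall c x y, V x -> V y -> V (e c * x + y).

Definition lincomb m (b : 'I_m -> A) (c : 'rV[K]_m) : A :=
  \sum_i e (c 0 i) * b i.

Lemma lincombL m (b : 'I_m -> A) k c c' :
  lincomb b (k *: c + c') = e k * lincomb b c + lincomb b c'.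
Proof.
rewrite /lincomb mulr_sumr -big_split; apply: eq_bigr => i _.
by rewrite !mxE rmorphD rmorphM mulrDl mulrA.
Qed.

Lemma lincomb0 m (b : 'I_m -> A) : lincomb b 0 = 0.
Proof. by rewrite /lincomb big1 // => i _; rewrite mxE rmorph0 mul0r. Qed.

Lemma lincombB m (b : 'I_m -> A) c c' :
  lincomb b (c - c') = lincomb b c - lincomb b c'.
Proof.
by rewrite -[- c']scaleN1r addrC lincombL rmorphN1 mulN1r addrC.
Qed.

Lemma subspace_lincomb V m (b : 'I_m -> A) c :
  subspace V -> (forall i, V (b i)) -> V (lincomb b c).
Proof.
by move=> [V0 VL] Vb; apply: (big_ind V) => // [x y Vx Vy|i _];
  [rewrite -[x]mul1r -(rmorph1 e)|rewrite -[X in V X]addr0]; apply: VL.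
Qed.

Lemma lincomb_mulmx m k (b : 'I_m -> A) c (M : 'M[K]_(k, m)) :
  lincomb b (c *m M) = lincomb (fun i => lincomb b (row i M)) c.
Proof.
rewrite /lincomb; under [RHS]eq_bigr do rewrite mulr_sumr.
rewrite exchange_big; apply: eq_bigr => j _.
rewrite mxE rmorph_sum mulr_suml; apply: eq_bigr => i _.
by rewrite rmorphM mxE mulrA.
Qed.

Lemma has_dimP V d : subspace V ->
  has_dim e V d <-> exists2 b : 'I_d -> A, (forall i, V (b i)) &
    (forall x, V x -> exists c, x = lincomb b c) /\
    (forall c, lincomb b c = 0 -> c = 0).
Proof.
move=> [V0 _]; split=> -[b Vb].
- move=> H; exists b => //; split=> [x /H[c [-> _]]|c c0]; first by exists c.
  have [c' [_ uc]] := H _ V0.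
  by rewrite -(uc c (esym c0)) (uc 0 (esym (lincomb0 b))).
- move=> [H1 H2]; exists b => // x Vx; have [c xE] := H1 x Vx; exists c.
  split=> // c' xE'; apply/eqP; rewrite -subr_eq0; apply/eqP/H2.
  by rewrite lincombB -xE [X in X - _]xE' subrr.
Qed.

Lemma row_free_lincomb m (b : 'I_m -> A) k (M : 'M[K]_(k, m)) :
  row_free M -> (forall c, (c <= M)%MS -> lincomb b c = 0 -> c = 0) ->
  forall c, lincomb (fun i => lincomb b (row i M)) c = 0 -> c = 0.
Proof.
move=> Mfree H c; rewrite -lincomb_mulmx => /(H _ (submxMl _ _)) cM0.
by apply: (row_free_inj Mfree); rewrite mul0mx.
Qed.

(** In coordinates with respect to [b], the preimage of [V] is the row space of some [M] and the
    relations form some [N <= M]; a basis of a complement of [N] in [M] maps to a basis of [V]. *)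
Lemma has_dim_exists V m (b : 'I_m -> A) : subspace V ->
  (forall x, V x -> exists c, x = lincomb b c) -> exists d, has_dim e V d.
Proof.
move=> sV Vb; have [V0 VL] := sV.
have [M ME] : exists M : 'M[K]_m, forall v, V (lincomb b v) <-> (v <= M)%MS.
  apply: subspace_row_space => [|c x y Sx Sy]; first by rewrite lincomb0.
  by rewrite lincombL; exact: VL.
have [N NE] : exists N : 'M[K]_m, forall v, lincomb b v = 0 <-> (v <= N)%MS.
  apply: subspace_row_space => [|c x y Sx Sy]; first by rewrite lincomb0.
  by rewrite lincombL Sx Sy mulr0 addr0.
have NM : (N <= M)%MS.
  apply/row_subP => i; apply/ME; have /NE-> : (row i N <= N)%MS by exact: row_sub.
  exact: V0.
pose B := row_base (M :\: N)%MS; exists (\rank (M :\: N)%MS).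
have BM : (B <= M)%MS by rewrite eq_row_base diffmxSl.
apply/(has_dimP _ sV); exists (fun i => lincomb b (row i B)).
  by move=> i; apply/ME; apply: submx_trans BM; exact: row_sub.
split.
- move=> x Vx; have [c xE] := Vb x Vx.
  have cM : (c <= M)%MS by apply/ME; rewrite -xE.
  have : (c <= (M :\: N) + N)%MS.
    apply: submx_trans cM _; rewrite -{1}(addsmx_diff_cap_eq M N).
    by rewrite addsmxS // capmxSr.
  case/sub_addsmxP => -[u v] /= cE.
  have /submxP[w wE] : (u *m (M :\: N) <= B)%MS by rewrite eq_row_base submxMl.
  exists w; rewrite -lincomb_mulmx -wE xE cE -[X in lincomb b (X + _)]scale1r lincombL.
  rewrite rmorph1 mul1r; have /NE-> : (v *m N <= N)%MS by exact: submxMl.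
  by rewrite addr0.
- apply: row_free_lincomb; first exact: row_base_free.
  move=> c; rewrite eq_row_base => cD /NE cN; apply/eqP; rewrite -submx0.
  by rewrite -(capmx_diff M N) sub_capmx cN cD.
Qed.

End Subspaces.

Section LinearMaps.
Variables (K : fieldType) (A A' : comPzRingType).
Variables (e : {rmorphism K -> A}) (e' : {rmorphism K -> A'}).
Variables (V : set A) (W : set A') (f : A -> A').
Hypotheses (sV : subspace e V) (sW : subspace e' W).
Hypothesis fVW : forall x, V x -> W (f x).
Hypothesis fL : forall c x y, V x -> V y -> f (e c * x + y) = e' c * f x + f y.

Lemma linear_map0 : f 0 = 0.
Proof.
have [V0 _] := sV; have := fL (- 1) V0 V0.
by rewrite mulr0 addr0 rmorphN1 mulN1r addNr.
Qed.

Lemma linear_map_lincomb m (b : 'I_m -> A) c :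
  (forall i, V (b i)) -> f (lincomb e b c) = lincomb e' (f \o b) c.
Proof.
move=> Vb; rewrite /lincomb.
suff [] : V (\sum_i e (c 0 i) * b i) /\
  f (\sum_i e (c 0 i) * b i) = \sum_i e' (c 0 i) * (f \o b) i by [].
have [V0 VL] := sV.
elim/big_rec2 : _ => [|i y' y _ [Vy yE]]; first by split=> //; exact: linear_map0.
by split; [exact: VL|rewrite fL // yE].
Qed.

Hypothesis f_inj : forall x, V x -> f x = 0 -> x = 0.

(** The matrix of an injective map is row free, hence invertible when the two dimensions agree. *)
Lemma has_dim_inj d d' : has_dim e V d -> has_dim e' W d' ->
  (d <= d')%N /\ (d = d' -> forall y, W y -> exists2 x, V x & f x = y).
Proof.
move=> /(has_dimP _ sV)[b Vb [_ b0]] /(has_dimP _ sW)[b' Wb' [b'W _]].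
have /choice[F fE] i := b'W _ (fVW (Vb i)).
pose M := \matrix_i F i.
have fM c : f (lincomb e b c) = lincomb e' b' (c *m M).
  rewrite linear_map_lincomb // lincomb_mulmx; congr lincomb.
  by apply/funext => i /=; rewrite fE rowK.
have Mfree : row_free M.
  rewrite -kermx_eq0 -submx0; apply/row_subP => i; set c := row i _.
  have cM : c *m M = 0 by apply/sub_kermxP/row_sub.
  suff -> : c = 0 by exact: sub0mx.
  apply: b0; apply: f_inj; first exact: subspace_lincomb.
  by rewrite fM cM lincomb0.
split; first by move: Mfree => /eqP<-; exact: rank_leq_col.
move=> dd' y /b'W[c' ->]; subst d'.
have /submxP[c ->] : (c' <= M)%MS.
  by apply: submx_full; rewrite row_full_unit -row_free_unit.
by exists (lincomb e b c); [exact: subspace_lincomb|exact: fM].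
Qed.

Lemma has_dim_bij d : has_dim e V d ->
  (forall y, W y -> exists2 x, V x & f x = y) -> has_dim e' W d.
Proof.
move=> /(has_dimP _ sV)[b Vb [bV b0]] f_surj; apply/(has_dimP _ sW).
exists (f \o b) => [i|]; first exact: fVW.
split=> [_ /f_surj[x /bV[c ->] <-]|c]; first by exists c; rewrite linear_map_lincomb.
rewrite -linear_map_lincomb // => fc0; apply: b0; apply: f_inj => //.
exact: subspace_lincomb.
Qed.

End LinearMaps.

Section SubspaceDimension.
Variables (K : fieldType) (A : comPzRingType) (e : {rmorphism K -> A}).

Lemma has_dim_sub V W d d' : subspace e V -> subspace e W -> V `<=` W ->
  has_dim e V d -> has_dim e W d' -> (d <= d')%N /\ (d = d' -> W `<=` V).
Proof.
move=> sV sW VW Vd Wd.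
have [dd' H] := @has_dim_inj _ _ _ e e V W id sV sW VW
  (fun _ _ _ _ _ => erefl) (fun _ _ => id) d d' Vd Wd.
by split=> // /H {}H x /H[y Vy <-].
Qed.

Lemma has_dim_uniq V d d' : subspace e V ->
  has_dim e V d -> has_dim e V d' -> d = d'.
Proof.
move=> sV Vd Vd'; apply/eqP; rewrite eqn_leq.
by rewrite (has_dim_sub sV sV _ Vd Vd').1 // (has_dim_sub sV sV _ Vd' Vd).1.
Qed.

Lemma dimK_has_dim V d : has_dim e V d -> has_dim e V (dimK e V).
Proof. by move=> Vd; apply: (xgetPex 0%N); exists d. Qed.

Lemma has_dim_sub_exists V W d : subspace e V -> subspace e W -> V `<=` W ->
  has_dim e W d -> exists d', has_dim e V d'.
Proof.
move=> sV sW VW /(has_dimP _ sW)[b _ [bW _]].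
by apply: (has_dim_exists (b := b) sV) => x /VW/bW.
Qed.

(* given line as soon as [k + 2 <= d].                                        *)
Lemma exists_solution_off_line V d k (t : 'I_k -> A -> K) u :
  subspace e V -> has_dim e V d -> (k + 2 <= d)%N ->
  (forall i c x y, V x -> V y -> t i (e c * x + y) = c * t i x + t i y) ->
  exists2 x, V x & (forall i, t i x = 0) /\ forall c, x <> e c * u.
Proof.
move=> sV /(has_dimP _ sV)[b Vb [bV b0]] kd tL.
have tb i c : t i (lincomb e b c) = \sum_j c 0 j * t i (b j).
  exact: (@linear_map_lincomb _ A K e idfun V (t i) sV (tL i)).
pose T := \matrix_(j < d, i < k) t i (b j).
have rT : (2 <= \rank (kermx T))%N.
  rewrite mxrank_ker leq_subRL ?rank_leq_row // (leq_trans _ kd) //.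
  by rewrite leq_add2r rank_leq_col.
(* [u'] holds the coordinates of [u], or 0 when [u] is not in [V], in which case the line meets [V]
   only in 0. A solution space of rank at least 2 does not fit into the span of one row. *)
have [u' u'P] : exists u' : 'rV_d,
    forall v c, lincomb e b v = e c * u -> (v <= u')%MS.
  have [[u' uE]|nu] := pselect (exists u', u = lincomb e b u').
    exists u' => v c vE; suff -> : v = c *: u' by exact: scalemx_sub.
    apply/eqP; rewrite -subr_eq0; apply/eqP/b0.
    by rewrite lincombB vE uE -[c *: u']addr0 lincombL lincomb0 addr0 subrr.
  exists 0 => v c vE; have [c0|c0] := eqVneq c 0.
    suff -> : v = 0 by exact: sub0mx.
    by apply: b0; rewrite vE c0 rmorph0 mul0r.
  case: nu; exists (c^-1 *: v).
  rewrite -[_ *: _]addr0 lincombL lincomb0 addr0 vE mulrA.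
  by rewrite -rmorphM mulVf // rmorph1 mul1r.
have : ~~ (kermx T <= u')%MS.
  by apply/negP => /mxrankS; rewrite leqNgt (leq_ltn_trans (rank_leq_row _)).
move=> /row_subPn[i]; set v := row i _ => vu'.
have vT : v *m T = 0 by apply/sub_kermxP/row_sub.
exists (lincomb e b v); first exact: subspace_lincomb.
split=> [j|c /u'P vu]; last by rewrite vu in vu'.
have <- : (v *m T) 0 j = 0 by rewrite vT; exact: mxE.
by rewrite tb [RHS]mxE; apply: eq_bigr => l _; rewrite [T l j]mxE.
Qed.

End SubspaceDimension.

(** * Units in hyperplanes of finite-dimensional algebras *)

Lemma infinite_field_nonroot (K : fieldType) (p : {poly K}) :
  infinite_set [set: K] -> p != 0 -> exists s, p.[s] != 0.
Proof.
move=> infK p0; apply: contrapT => nex.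
have [B _ Bn] := infinite_set_fset (size p) infK.
have rB : all (root p) B.
  by apply/allP => s _; apply/negPn/negP => s0; apply: nex; exists s.
by have := max_poly_roots p0 rB (fset_uniq B); rewrite ltnNge Bn.
Qed.

Section Units.
Variables (K : fieldType) (A : comPzRingType) (e : {rmorphism K -> A}).
Variables (B : set A) (d : nat).
Hypotheses (B_scalar : forall c, B (e c)).
Hypotheses (BD : forall x y, B x -> B y -> B (x + y)).
Hypotheses (BM : forall x y, B x -> B y -> B (x * y)).
Hypothesis (dimB : has_dim e B d).

Lemma subalgebra_subspace : subspace e B.
Proof.
by split=> [|c x y Bx By]; [rewrite -(rmorph0 e)|apply/BD/By/BM].
Qed.

Lemma subalgebraX w k : B w -> B (w ^+ k).
Proof.
move=> Bw; elim: k => [|k IH]; first by rewrite expr0 -(rmorph1 e).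
by rewrite exprS; exact: BM.
Qed.

Lemma algebraic_relation (w : A) : B w -> exists2 p : {poly K}, p != 0 &
  exists2 n, (size p <= n)%N & \sum_(i < n) e p`_i * w ^+ i = 0.
Proof.
move=> Bw; have [b _ [bB _]] := (has_dimP _ subalgebra_subspace).1 dimB.
have /choice[F FE] (i : 'I_d.+1) := bB (w ^+ i) (subalgebraX i Bw).
have : kermx (\matrix_i F i) != 0.
  by rewrite kermx_eq0 /row_free neq_ltn ltnS rank_leq_col.
move=> /rowV0Pn[c /sub_kermxP cF c0]; exists (rVpoly c).
  by apply: contra c0 => /eqP c0; rewrite -[c]rVpolyK c0 raddf0.
exists d.+1; first exact: size_poly.
transitivity (lincomb e b (c *m \matrix_i F i)).
  rewrite lincomb_mulmx; apply: eq_bigr => i _.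
  by rewrite coef_rVpoly_ord rowK -FE.
by rewrite cF lincomb0.
Qed.

(** Divide a polynomial relation of [w] by its lowest nonzero coefficient, at index [k]: all other
    terms are multiples of [w^(k+1)]. *)
Lemma strongly_pi_regular (w : A) : B w ->
  exists k, exists2 z, B z & w ^+ k = w ^+ k.+1 * z.
Proof.
move=> Bw; have [p p0 [n pn pw]] := algebraic_relation Bw.
have ex : exists k, p`_k != 0.
  by exists (size p).-1; rewrite -/(lead_coef p) lead_coef_eq0.
case: (ex_minnP ex) => k pk kmin; exists k.
have kn : (k < n)%N.
  by apply: leq_trans pn; rewrite ltnNge; apply: contra pk => /leq_sizeP->.
pose z := \sum_(i < n | i != Ordinal kn) e p`_i * w ^+ (i - k.+1).
exists (e (- (p`_k)^-1) * z).
  apply: BM => //; apply: (big_ind B) => [|//|i _].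
    by rewrite -(rmorph0 e).
  by apply: BM => //; exact: subalgebraX.
move: pw; rewrite (bigD1 (Ordinal kn)) //=.
have -> : \sum_(i < n | i != Ordinal kn) e p`_i * w ^+ i = w ^+ k.+1 * z.
  rewrite /z mulr_sumr; apply: eq_bigr => i ik.
  have [ki|ki] := ltnP k i; first by rewrite mulrCA -exprD subnKC.
  suff -> : p`_i = 0 by rewrite rmorph0 !mul0r mulr0.
  apply/eqP/negPn/negP => /kmin ik'; case/eqP: ik; apply/val_inj/eqP.
  by rewrite eqn_leq ki ik'.
move=> /(congr1 ( *%R (e ((p`_k)^-1)))); rewrite mulr0 mulrDr mulrA -rmorphM mulVf //.
by rewrite rmorph1 mul1r => /eqP; rewrite addr_eq0 => /eqP->; rewrite rmorphN; ring.
Qed.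

(** An eigenvalue is a root of every annihilating polynomial; so an [s] that is not a root leaves no
    nonzero eigenvector [b]. *)
Lemma eigenvalue_root (w b : A) (s : K) (p : {poly K}) n : (size p <= n)%N ->
  \sum_(i < n) e p`_i * w ^+ i = 0 -> w * b = e s * b -> e p.[s] * b = 0.
Proof.
move=> pn pw wb; have wib i : w ^+ i * b = e (s ^+ i) * b.
  elim: i => [|i IH]; first by rewrite !expr0 rmorph1.
  by rewrite exprS -mulrA IH mulrCA wb mulrA -rmorphM mulrC -exprSr mulrC.
transitivity ((\sum_(i < n) e p`_i * w ^+ i) * b); last by rewrite pw mul0r.
rewrite (horner_coef_wide _ pn) rmorph_sum !mulr_suml.
by apply: eq_bigr => i _; rewrite rmorphM -!mulrA wib.
Qed.

(** The kernel of the map from [A] to its localization at [a]. *)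
Definition nil_at (a : A) : set A := [set b | exists k, a ^+ k * b = 0].

Lemma nil_at_widen (a b : A) k l : (k <= l)%N -> a ^+ k * b = 0 -> a ^+ l * b = 0.
Proof. by move=> kl ab; rewrite -(subnK kl) exprD -mulrA ab mulr0. Qed.

Lemma nil_at_subspace (a : A) : subspace e (nil_at a).
Proof.
split=> [|c x y [k ax] [l ay]]; first by exists 0%N; rewrite mulr0.
exists (k + l)%N; rewrite mulrDr mulrCA (nil_at_widen (leq_addr _ _) ax) mulr0.
by rewrite (nil_at_widen (leq_addl _ _) ay) addr0.
Qed.

Lemma nil_atD (a c b : A) : nil_at a b -> nil_at c b -> nil_at (a + c) b.
Proof.
move=> [k ab] [l cb]; exists (k + l)%N; rewrite exprDn mulr_suml big1 // => i _.
rewrite mulrnAl; have [kj|jk] := leqP k (k + l - i).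
  by rewrite mulrAC (nil_at_widen kj ab) mul0r mul0rn.
rewrite -mulrA (nil_at_widen _ cb) ?mulr0 ?mul0rn //.
by rewrite -(leq_add2l k) -leq_subLR -ltnS; lia.
Qed.

Lemma nil_atM (a c b : A) : nil_at a b -> nil_at (c * a) b.
Proof. by move=> [k ab]; exists k; rewrite exprMn -mulrA ab mulr0. Qed.

Hypothesis (infK : infinite_set [set: K]).

(* For u in H the ideal N(u) = nil_at u is the part of A on which u is not    *)
(* invertible. If h in H is not nilpotent on N(u) then, for all but finitely  *)
(* many scalars s, v = s u - h satisfies N(v) < N(u). So when N(u) has        *)
(* minimal dimension, all of H is nilpotent on N(u), and lies in a proper     *)
(* ideal unless N(u) = 0.                                                     *)
Lemma exists_unit (H : set A) : subspace e H -> H `<=` B ->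
  (forall M : set A, (forall a x y, B a -> M x -> M y -> M (a * x + y)) ->
     ~ M 1 -> ~ H `<=` M) ->
  exists2 u, H u & exists2 z, B z & u * z = 1.
Proof.
move=> [H0 HL] HB Hideal; pose N u := nil_at u `&` B.
have sN u : subspace e (N u).
  have [N0 NL] := nil_at_subspace u; have [B0 BL] := subalgebra_subspace.
  by split=> // c x y [Nx Bx] [Ny By]; split; [exact: NL|exact: BL].
have dimN u : exists n, has_dim e (N u) n.
  exact: has_dim_sub_exists (sN u) subalgebra_subspace (@subIsetr _ _ _) dimB.
have ex : exists n, `[< exists2 u, H u & has_dim e (N u) n >].
  by have [n n0] := dimN 0; exists n; apply/asboolP; exists 0.
case: (ex_minnP ex) => n /asboolP[u Hu un] nmin.
exists u => //; have [k [z Bz uz]] := strongly_pi_regular (HB _ Hu); exists z => //.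
have {}uz j : (k <= j)%N -> u ^+ j * (u * z) = u ^+ j.
  by move=> kj; rewrite -(subnK kj) exprD -mulrA; congr (_ * _); rewrite mulrA -exprSr.
have uk b : nil_at u b -> u ^+ k * b = 0.
  case=> j ub; have := nil_at_widen (leq_addl k j) ub; elim: j {ub} => [|j IH].
    by rewrite addn0.
  move=> ub; apply: IH; rewrite -uz ?leq_addr // mulrA -exprSr -addnS.
  by rewrite mulrAC ub mul0r.
(* [u^k] kills [1 - u z], so [N u = 0] turns [z] into an inverse of [u]. *)
suff N0 : N u `<=` [set 0].
  apply/eqP; rewrite eq_sym -subr_eq0; apply/eqP/N0; split.
    by exists k; rewrite mulrBr mulr1 uz // subrr.
  apply: BD; first by rewrite -(rmorph1 e).
  by rewrite -mulN1r -(rmorphN1 e); apply: BM => //; apply: BM => //; exact: HB.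
apply: contrapT => N0.
have nilH h b : H h -> N u b -> nil_at h b.
  move=> Hh ub; have [p p0 [m pm pw]] := algebraic_relation (BM Bz (HB _ Hh)).
  have [s ps] := infinite_field_nonroot infK p0.
  pose v := e s * u - h.
  have Hv : H v by rewrite /v -[- h]addr0 -mulN1r -(rmorphN1 e); exact/HL/HL.
  (* On multiples [c'] of [u^k] the product [u z] acts as 1. If moreover [v c' = 0], then
     [z h c' = s c'], and [c' = 0] because [s] is not a root of the polynomial [p] annihilating
     [z h]. *)
  have Nvu : N v `<=` N u.
    move=> c [[j vc] Bc]; split=> //; suff uc : u ^+ k * c = 0 by exists k.
    have : v ^+ j * (u ^+ k * c) = 0 by rewrite mulrCA vc mulr0.
    elim: j {vc} => [|j IH]; first by rewrite mul1r.
    rewrite exprSr -mulrA => vc; apply: IH.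
    set c' := v ^+ j * _; have c'0 : v * c' = 0.
      by rewrite /c' -[RHS]vc; ring.
    have {}c'0 : h * c' = e s * u * c'.
      by apply/esym/eqP; rewrite -subr_eq0 -mulrBl c'0.
    have c'u : u * z * c' = c'.
      by rewrite /c' -[in RHS](uz k) //; ring.
    have : z * h * c' = e s * c'.
      by rewrite -mulrA c'0 -[in RHS]c'u; ring.
    move=> /(eigenvalue_root pm pw)/(congr1 ( *%R (e (p.[s]^-1)))).
    by rewrite mulr0 mulrA -rmorphM mulVf // rmorph1 mul1r.
  have [l vl] := dimN v.
  have [ln nl] := has_dim_sub (sN v) (sN u) Nvu vl un.
  have nE : n = l.
    by apply/eqP; rewrite eqn_leq ln andbT; apply/nmin/asboolP; exists v.
  have [vb _] : N v b by exact: nl (esym nE) _ ub.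
  case: ub => ub _.
  have -> : h = e s * u + (- 1) * v by rewrite /v; ring.
  by apply: nil_atD; exact: nil_atM.
apply: (Hideal [set a | forall b, N u b -> nil_at a b]) => //=.
- by move=> a x y _ Mx My b ub; apply: nil_atD; [apply/nil_atM/Mx|exact: My].
- by move=> M1; apply: N0 => b /M1[j]; rewrite expr1n mul1r.
- by move=> h Hh b; exact: nilH.
Qed.

End Units.

(** * Homogeneous components and points of Proj *)

Lemma sum_widen_support (V : zmodType) (u : int -> V) (s t : seq int) :
  uniq s -> uniq t -> {subset s <= t} -> (forall i, i \notin s -> u i = 0) ->
  \sum_(i <- s) u i = \sum_(i <- t) u i.
Proof.
move=> us ut st u0; rewrite [RHS](bigID (mem s)) /= [X in _ + X]big1; last first.
  by move=> i /u0.
rewrite addr0 -[RHS]big_filter; apply: perm_big; apply: uniq_perm => //.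
  exact: filter_uniq.
by move=> i; rewrite mem_filter; case: (boolP (i \in s)) => //= /st->.
Qed.

Section Components.
Variables (V : zmodType) (V_ : int -> set V).
Hypothesis Vdec : forall x, exists! u, homog_decomposition V_ x u.
Hypothesis VB : forall i x y, V_ i x -> V_ i y -> V_ i (x - y).

Definition hcomp (i : int) (x : V) : V := projT1 (cid (Vdec x)) i.

Lemma comp_decomposition x : homog_decomposition V_ x (hcomp ^~ x).
Proof. by have [] := projT2 (cid (Vdec x)). Qed.

Lemma comp_uniq x u : homog_decomposition V_ x u -> forall i, hcomp i x = u i.
Proof. by move=> /(projT2 (cid (Vdec x))).2 H i; rewrite /hcomp H. Qed.

Lemma comp_deg i x : V_ i (hcomp i x).
Proof. exact: (comp_decomposition x).1. Qed.

Lemma comp_support x : exists s : seq int,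
  [/\ uniq s, forall i, i \notin s -> hcomp i x = 0 & x = \sum_(i <- s) hcomp i x].
Proof. exact: (comp_decomposition x).2. Qed.

Lemma homog0 i : V_ i 0.
Proof. by rewrite -(subrr (hcomp i 0)); apply: VB; exact: comp_deg. Qed.

Lemma homogD i x y : V_ i x -> V_ i y -> V_ i (x + y).
Proof.
move=> Vx Vy; have -> : x + y = x - (0 - y) by rewrite sub0r opprK.
by do 2![apply: VB => //]; exact: homog0.
Qed.

Lemma comp_homog i j x : V_ j x -> hcomp i x = if i == j then x else 0.
Proof.
move=> Vx; apply: (comp_uniq (u := fun i => if i == j then x else 0)).
split=> [k|]; first by case: eqP => [->|_] //; exact: homog0.
exists [:: j]; split=> // [k|]; first by rewrite inE => /negPf->.
by rewrite big_seq1 eqxx.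
Qed.

Lemma compB i x y : hcomp i (x - y) = hcomp i x - hcomp i y.
Proof.
apply: (comp_uniq (u := fun i => hcomp i x - hcomp i y)); split=> [k|].
  by apply: VB; exact: comp_deg.
have [s [us s0 sE]] := comp_support x; have [t [ut t0 tE]] := comp_support y.
exists (undup (s ++ t)); rewrite undup_uniq; split=> // [k|].
  by rewrite mem_undup mem_cat negb_or => /andP[/s0-> /t0->]; rewrite subrr.
rewrite {1}sE {1}tE sumrB; congr (_ - _).
  apply: sum_widen_support => //; first exact: undup_uniq.
  by move=> k; rewrite mem_undup mem_cat => ->.
apply: sum_widen_support => //; first exact: undup_uniq.
by move=> k; rewrite mem_undup mem_cat orbC => ->.
Qed.

Lemma comp0 i : hcomp i 0 = 0.
Proof. by have := compB i 0 0; rewrite !subrr. Qed.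

Lemma compD i x y : hcomp i (x + y) = hcomp i x + hcomp i y.
Proof.
by have -> : x + y = x - (0 - y); rewrite ?compB ?comp0 ?sub0r ?opprK.
Qed.

Lemma comp_sum i (I : Type) (s : seq I) (P : pred I) (F : I -> V) :
  hcomp i (\sum_(k <- s | P k) F k) = \sum_(k <- s | P k) hcomp i (F k).
Proof. by apply: (big_morph (hcomp i)) => [x y|]; [exact: compD|exact: comp0]. Qed.

Lemma comp_eq x y : (forall i, hcomp i x = hcomp i y) -> x = y.
Proof.
move=> xy; apply/eqP; rewrite -subr_eq0; apply/eqP.
have [s [_ _ ->]] := comp_support (x - y).
by apply: big1 => i _; rewrite compB xy subrr.
Qed.

End Components.

Section ComponentsMul.
Variables (A : comPzRingType) (A_ : int -> set A).
Hypothesis Adec : forall x, exists! u, homog_decomposition A_ x u.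
Hypothesis AB : forall i x y, A_ i x -> A_ i y -> A_ i (x - y).
Hypothesis AM : forall i j x y, A_ i x -> A_ j y -> A_ (i + j) (x * y).
Local Notation hcomp := (hcomp Adec).

Lemma compMr k j x y : A_ j y -> hcomp k (x * y) = hcomp (k - j) x * y.
Proof.
move=> Ay; have [s [us s0 sE]] := comp_support Adec x.
rewrite {1}sE mulr_suml comp_sum //.
under eq_bigr => i _ do
  rewrite (comp_homog Adec AB _ (AM (comp_deg Adec i x) Ay)).
rewrite -big_mkcond.
have [ks|/[dup] ks /s0->] := boolP (k - j \in s).
  rewrite (big_rem _ ks) /= subrK eqxx big_seq_cond big1 ?addr0 // => i.
  rewrite mem_rem_uniq // !inE -andbA => /and3P[ik _ /eqP kE].
  by rewrite kE addrK eqxx in ik.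
rewrite mul0r big_seq_cond big1 // => i /andP[si /eqP kE].
by rewrite kE addrK si in ks.
Qed.

Lemma compM k x y : exists t : seq int,
  [/\ uniq t, forall i, i \notin t -> hcomp i y = 0 &
  hcomp k (x * y) = \sum_(j <- t) hcomp (k - j) x * hcomp j y].
Proof.
have [t [ut t0 tE]] := comp_support Adec y; exists t; split=> //.
rewrite {1}tE mulr_sumr comp_sum //; apply: eq_bigr => j _.
by rewrite (compMr k x (comp_deg Adec j y)).
Qed.

End ComponentsMul.

Lemma ga_deg_subspace (K : fieldType) (R : graded_algebra K) i :
  subspace (ga_scalar R) (ga_deg R i).
Proof.
split=> [|c x y xi yi]; first exact: ga_deg0.
apply: ga_degD => //; rewrite -[i]add0r; apply: ga_degM => //.
exact: ga_deg_scalar.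
Qed.

(** * Points of Proj containing a given homogeneous ideal *)

Section HomogeneousIdeals.
Variables (K : fieldType) (R : graded_algebra K).
Local Notation R_ := (ga_deg R).
Local Notation Rdec := (@ga_decomposition K R).
Local Notation RB := (@ga_degB K R).
Local Notation RM := (@ga_degM K R).

Definition pc := hcomp Rdec.

Definition homog_idealset (J : set R) : Prop :=
  [/\ J 0, forall a x y, J x -> J y -> J (a * x + y)
    & forall i x, J x -> J (pc i x)].

Section Prime.
Variables (J : set R) (y : R).
Hypotheses (hJ : homog_idealset J) (Jy : forall k, ~ J (y ^+ k)).
Hypothesis Jmax : forall J', homog_idealset J' -> (forall k, ~ J' (y ^+ k)) ->
  J `<=` J' -> J' `<=` J.

(** If both factors were outside [J], maximality would put powers of [y] into [J + (f)] and
    [J + (g)], and their product into [J]. *)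
Lemma maximal_prime_homog i j f g :
  R_ i f -> R_ j g -> J (f * g) -> J f \/ J g.
Proof.
move=> fi gj Jfg; apply: contrapT => /not_orP[nf ng].
have [J0 JL Jc] := hJ.
have add h d : R_ d h -> ~ J h -> exists k q a, J q /\ y ^+ k = q + a * h.
  move=> hd nh; apply: contrapT => nex; apply: nh.
  apply: (Jmax (J' := [set x | exists q a, J q /\ x = q + a * h])).
  - split=> [|a _ _ [q [b [Jq ->]]] [q' [b' [Jq' ->]]]|k _ [q [a [Jq ->]]]].
    + by exists 0, 0; split=> //; ring.
    + exists (a * q + q'), (a * b + b'); split; [exact: JL|ring].
    + exists (pc k q), (pc (k - d) a); split; first exact: Jc.
      by rewrite /pc compD ?(compMr Rdec RB RM _ _ hd) //; exact: RB.
  - by move=> k [q [a [Jq yk]]]; apply: nex; exists k, q, a.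
  - by move=> x Jx; exists x, 0; split=> //; ring.
  - by exists 0, 1; split=> //; ring.
have [k [q [a [Jq yk]]]] := add f i fi nf.
have [l [q' [a' [Jq' yl]]]] := add g j gj ng.
apply: (Jy (k := k + l)); rewrite exprD yk yl.
have -> : (q + a * f) * (q' + a' * g) =
  (q' + a' * g) * q + (a * f * q' + (a * a' * (f * g) + 0)) by ring.
by apply: (JL) => //; apply: (JL) => //; exact: JL.
Qed.

Lemma int_seq_max (s : seq int) (P : int -> Prop) :
  (exists2 i, i \in s & P i) -> exists2 i, P i & forall j, j \in s -> P j -> j <= i.
Proof.
elim: s => [|a s IH]; first by case.
have [[i si Pi]|ns] := pselect (exists2 i, i \in s & P i).
  move=> _; have [|m Pm mmax] := IH; first by exists i.
  have [Pa|nPa] := pselect (P a /\ m <= a).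
    exists a => [|j]; first by case: Pa.
    by rewrite inE => /orP[/eqP->//|js Pj]; apply: le_trans (mmax _ js Pj) Pa.2.
  exists m => // j; rewrite inE => /orP[/eqP-> Pa|]; last exact: mmax.
  by rewrite leNgt; apply/negP => /ltW ma; apply: nPa.
case=> i; rewrite inE => /orP[/eqP->{i} Pa|si Pi]; last by case: ns; exists i.
exists a => // j; rewrite inE => /orP[/eqP->//|js Pj]; case: ns; by exists j.
Qed.

Lemma top_component f : ~ J f ->
  exists2 i, ~ J (pc i f) & forall j, i < j -> J (pc j f).
Proof.
move=> nf; have [J0 JL _] := hJ.
have [s [us s0 sE]] := comp_support Rdec f.
have [|i Pi imax] := @int_seq_max s (fun i => ~ J (pc i f)).
  apply: contrapT => nex; apply: nf; rewrite sE big_seq.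
  apply: (big_ind J) => // [x z Jx Jz|i si]; first by rewrite -[x]mul1r; exact: JL.
  by apply: contrapT => nJ; apply: nex; exists i.
exists i => // j ij; apply: contrapT => nJ.
have [js|/s0 j0] := boolP (j \in s); last by apply: nJ; rewrite /pc j0.
by have := imax j js nJ; rewrite leNgt ij.
Qed.

(** Reduction to homogeneous factors: if [i] and [j] are the top degrees in which [f] and [g] have
    components outside [J], the component of [f g] in degree [i + j] is the product of these two
    modulo [J]. *)
Lemma maximal_prime f g : J (f * g) -> J f \/ J g.
Proof.
move=> Jfg; apply: contrapT => /not_orP[nf ng].
have [J0 JL Jc] := hJ.
have [i fi imax] := top_component nf; have [j gj jmax] := top_component ng.
have [t [ut t0 fgE]] := compM Rdec RB RM (i + j) f g.
have [] // := @maximal_prime_homog i j (pc i f) (pc j g) => //; try exact: comp_deg.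
have jt : j \in t.
  by apply/negPn/negP => /t0 gj0; apply: gj; rewrite /pc gj0.
have := Jc (i + j) _ Jfg; rewrite {1}/pc fgE (big_rem _ jt) /= addrK.
set S := \sum_(_ <- _) _ => JS.
suff JS' : J S.
  by rewrite -[X in J X](addrK S) addrC -mulN1r; exact: JL.
rewrite /S big_seq; apply: (big_ind J) => // [x z Jx Jz|k].
  by rewrite -[x]mul1r; exact: JL.
rewrite mem_rem_uniq // !inE => /andP[kj _].
have [jk|kj'|kE] := ltgtP j k.
- by rewrite -[_ * _]addr0; apply: JL => //; exact: jmax.
- rewrite mulrC -[_ * _]addr0; apply: JL => //; apply: imax.
  by rewrite -addrA ltrDl subr_gt0.
- by rewrite kE eqxx in kj.
Qed.

End Prime.

(** A homogeneous ideal maximal among those above [J] without powers of [y] is prime; it misses [y],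
    which lies in the irrelevant ideal because its degree is 1. *)
Lemma proj_point_exists (J : set R) (y : R) : homog_idealset J -> R_ 1 y ->
  (forall k, ~ J (y ^+ k)) -> exists2 p, Proj R p & J `<=` p.
Proof.
move=> hJ y1 Jy.
(* The condition is put on the union of [J] and [B], so that it also holds for the empty set, the
   union of the empty chain in Zorn's lemma. *)
pose P (B : set R) := homog_idealset (J `|` B) /\ forall k, ~ (J `|` B) (y ^+ k).
have [|B [[hB By] Bmax]] := @Zorn_bigcup R P.
  move=> F FP totF; have [[B0 FB0]|F0] := pselect (exists B, F B); last first.
    rewrite (_ : \bigcup_(X in F) X = set0) /P ?setU0 //.
    by apply/seteqP; split=> // x [B FB]; case: F0; exists B.
  have mem x : (J `|` \bigcup_(X in F) X) x -> exists2 B, F B & (J `|` B) x.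
    by case=> [Jx|[B FB Bx]]; [exists B0 => //; left|exists B => //; right].
  have sub B : F B -> J `|` B `<=` J `|` \bigcup_(X in F) X.
    by move=> FB x [Jx|Bx]; [left|right; exists B].
  split; first split.
  - by left; have [] := hJ.
  - move=> a x z /mem[B FB Bx] /mem[C FC Cz].
    have [BC|CB] := totF _ _ FB FC.
      apply: (sub _ FC); have [_ CL _] := (FP _ FC).1; apply: CL => //.
      by case: Bx => [|/BC]; [left|right].
    apply: (sub _ FB); have [_ BL _] := (FP _ FB).1; apply: BL => //.
    by case: Cz => [|/CB]; [left|right].
  - move=> i x /mem[B FB Bx]; apply: (sub _ FB).
    by have [_ _ Bc] := (FP _ FB).1; exact: Bc.
  - by move=> k /mem[B FB]; exact: (FP _ FB).2.
exists (J `|` B); last by left.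
have Pmax J' : homog_idealset J' -> (forall k, ~ J' (y ^+ k)) ->
    J `|` B `<=` J' -> J' `<=` J `|` B.
  move=> hJ' J'y BJ'; apply: contrapT => nJ'.
  have J'E : J `|` J' = J'.
    by apply/seteqP; split=> [x [Jx|]|x] //; [apply: BJ'; left|right].
  apply: (Bmax J'); last by rewrite /P J'E.
  split; first by move=> x Bx; apply: BJ'; right.
  by move=> J'B; apply: nJ' => x /J'B; right.
have [B0 BL Bc] := hB; set p := J `|` B in hB By Pmax B0 BL Bc *.
have memp x : reflect (p x) (x \in [pred f | f \in p]).
  by apply: (iffP idP); rewrite [_ \in _]/=; [exact: set_mem|exact: mem_set].
split.
- split; first exact/memp.
    by apply/memp => p1; apply: (By 0%N); rewrite expr0.
  by move=> a u v /memp up /memp vp; apply/memp/BL.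
- move=> u v /memp/(maximal_prime hB By Pmax)[/memp-> //|/memp->].
  by rewrite orbT.
- move=> f Bf; exists (pc ^~ f); first exact: comp_decomposition.
  by move=> i; exact: Bc.
- move=> sub; apply: (By 1%N); rewrite expr1; apply: sub.
  exists (pc ^~ y); first exact: comp_decomposition.
  move=> i i1; rewrite /pc (comp_homog Rdec RB _ y1); case: eqP => // iE.
  by rewrite iE ltxx in i1.
Qed.

Lemma annihilator_homog_ideal i f : R_ i f -> homog_idealset [set a | a * f = 0].
Proof.
move=> fi; split=> [|a x y /= xf yf|j x /= xf] /=; first exact: mul0r.
  by rewrite mulrDl -mulrA xf yf mulr0 addr0.
by rewrite -[j](addrK i) -(compMr Rdec RB RM _ _ fi) xf comp0 //; exact: RB.
Qed.

End HomogeneousIdeals.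

(** * The coordinate ring *)

Section CoordinateRing.
Variables (K : fieldType) (n : nat) (I : homog_ideal K n).
Local Notation R := (coord_ring I).
Local Notation R_ := (ga_deg R).
Local Notation P := {mpoly K[n.+1]}.

Definition coord_pi (p : P) : R := \pi_{ideal_quot I} p.

Lemma coord_piM p q : coord_pi (p * q) = coord_pi p * coord_pi q.
Proof. exact: rmorphM. Qed.

Lemma coord_piX p k : coord_pi (p ^+ k) = coord_pi p ^+ k.
Proof. exact: rmorphXn. Qed.

Lemma coord_pi_sum (J : Type) (s : seq J) (Q : pred J) (F : J -> P) :
  coord_pi (\sum_(i <- s | Q i) F i) = \sum_(i <- s | Q i) coord_pi (F i).
Proof. exact: rmorph_sum. Qed.

Lemma coord_piZ c p : coord_pi (c *: p) = ga_scalar R c * coord_pi p.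
Proof. by rewrite -mul_mpolyC coord_piM. Qed.

Lemma coord_pi_eq0 p : coord_pi p = 0 <-> p \in I.
Proof.
rewrite /coord_pi -[p in X in _ <-> X]subr0 Quotient.idealrBE; split=> [H|/eqP->].
  by apply/eqP; rewrite [LHS]H; symmetry; exact: rmorph0.
exact: rmorph0.
Qed.

Lemma coord_degN i f : i < 0 -> R_ i f -> f = 0.
Proof. by case: i. Qed.

Lemma coord_deg_pi d f : R_ (Posz d) f -> exists2 p, p \is d.-homog & f = coord_pi p.
Proof. by case=> p hp <-; exists p. Qed.

Lemma coord_pi_deg d p : p \is d.-homog -> R_ (Posz d) (coord_pi p).
Proof. by move=> hp; exists p. Qed.

Lemma coord_deg0_scalar f : R_ 0 f -> exists c, f = ga_scalar R c.
Proof.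
case/coord_deg_pi => p hp ->; exists p@_0%MM; congr coord_pi.
apply/mpolyP => m; rewrite mcoeffC eq_sym.
have [->|m0] := eqVneq m 0%MM; first by rewrite mulr1.
by rewrite mulr0; apply: (dhomog_nemf_coeff hp); rewrite mdeg_eq0.
Qed.

Lemma coord_x0_deg : R_ 1 (coord_x0 I).
Proof. by apply: coord_pi_deg; rewrite dhomogX; apply/eqP; exact: mdeg1. Qed.

(** [dimK] falls back to 0 without a finite basis. Here the monomials of degree at most [d] span, so
    [HF] is a true dimension. *)
Lemma has_dim_HF i : has_dim (ga_scalar R) (R_ i) (HF R i).
Proof.
suff [d Rd] : exists d, has_dim (ga_scalar R) (R_ i) d by exact: dimK_has_dim Rd.
case: i => [d|d]; last first.
  apply: (has_dim_exists (b := fun j : 'I_0 => 0) (ga_deg_subspace R _)) => x /= ->.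
  by exists 0; rewrite lincomb0.
pose T := 'X_{1..n.+1 < d.+1} : finType.
apply: (has_dim_exists (b := fun j : 'I_#|T| => coord_pi 'X_[bmnm (enum_val j)])
  (ga_deg_subspace R _)) => _ /coord_deg_pi[p hp ->].
exists (\row_j p@_(bmnm (enum_val j))).
have pd : (msize p <= d.+1)%N.
  by rewrite msizeE; apply/bigmax_leqP_seq => m mp _; rewrite ltnS (dhomog_mf hp mp).
rewrite {1}(mpolywE pd) coord_pi_sum (reindex_onto enum_val enum_rank) /=; last first.
  by move=> m _; exact: enum_rankK.
under eq_bigl do rewrite enum_valK eqxx.
by apply: eq_bigr => j _; rewrite coord_piZ mxE.
Qed.

Lemma HF0 : HF R 0 = 1%N.
Proof.
apply: has_dim_uniq (ga_deg_subspace R 0) (has_dim_HF 0) _.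
apply/(has_dimP _ (ga_deg_subspace R 0)).
exists (fun=> 1) => [_|]; first exact: ga_deg1.
split=> [x /coord_deg0_scalar[c ->]|c].
  by exists (const_mx c); rewrite /lincomb big_ord1 mxE mulr1.
rewrite /lincomb big_ord1 mulr1 => /eqP; rewrite fmorph_eq0 => /eqP c0.
by apply/rowP => j; rewrite ord1 c0 mxE.
Qed.

End CoordinateRing.

(** * The form [x_0] is a non-zerodivisor *)

Section NonZeroDivisor.
Variables (K : fieldType) (n : nat) (X : zero_scheme K n).
Local Notation R := (coord_ring X).
Local Notation x0 := (coord_x0 X).
Hypothesis x0_Supp : forall p, Proj R p -> ~ p x0.

(** If no power of some variable killed [f], a point of Proj would contain the annihilator of [f],
    and with it [x_0]. So every variable has a power killing [f], and saturation gives [f = 0]. *)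
Lemma coord_x0_homog_nonzerodivisor i f : ga_deg R i f -> x0 * f = 0 -> f = 0.
Proof.
move=> fi x0f.
pose x j : R := coord_pi X 'X_j.
have /choice[k kP] (j : 'I_n.+1) : exists k, x j ^+ k * f = 0.
  apply: contrapT => nex.
  have [||p Pp Jp] := proj_point_exists (annihilator_homog_ideal fi) (y := x j).
  - by apply: coord_pi_deg; rewrite dhomogX; apply/eqP; exact: mdeg1.
  - by move=> k xk; apply: nex; exists k.
  - by apply: (x0_Supp Pp); exact: Jp.
case: i fi => [i|i] fi; last exact: coord_degN fi.
have [p _ fE] := coord_deg_pi fi; rewrite fE; apply/coord_pi_eq0.
(* In this degree every monomial is divisible by some [x_j^(k_j)], by the pigeonhole principle. *)
apply: (@zs_saturated _ _ X _ (\sum_j k j).+1) => g hg.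
apply/coord_pi_eq0; rewrite coord_piM -fE (mpolyE g) coord_pi_sum mulr_suml.
rewrite big_seq big1 // => m mg; rewrite coord_piZ -mulrA.
suff -> : coord_pi X 'X_[m] * f = 0 by rewrite mulr0.
have mdegm : mdeg m = (\sum_j k j).+1 by exact: (dhomog_mf hg).
have [j kj] : exists j, (k j <= m j)%N.
  apply: contrapT => nex; have : (mdeg m <= \sum_j k j)%N.
    rewrite mdegE; apply: leq_sum => j _; rewrite leqNgt; apply/negP => /ltnW kj.
    by apply: nex; exists j.
  by rewrite mdegm ltnn.
rewrite mpolyXE_id (bigD1 j) //= coord_piM coord_piX -(subnK kj) exprD.
by rewrite mulrC mulrA [f * _]mulrC -[_ * f]mulrA kP mulr0 mul0r.
Qed.

Lemma coord_x0_nonzerodivisor f : x0 * f = 0 -> f = 0.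
Proof.
move=> x0f; apply: (comp_eq (Vdec := @ga_decomposition K R) (@ga_degB K R)) => i.
rewrite comp0 //; last exact: ga_degB.
apply: coord_x0_homog_nonzerodivisor; first exact: comp_deg.
have := compMr (@ga_decomposition K R) (@ga_degB K R) (@ga_degM K R)
  (i + 1) f (coord_x0_deg X).
rewrite addrK [f * _]mulrC x0f comp0; last exact: ga_degB.
by rewrite mulrC => <-.
Qed.

End NonZeroDivisor.

(** * The graded ring of fractions *)

Section QhRing.
Variables (K : fieldType) (R : graded_algebra K) (x0 : R).
Local Notation Q := (Qh x0).
Local Notation Qfrac := (Qfrac x0).
Local Notation Qinj := (Qinj x0).

Lemma QfracW (q : Q) : exists f k, q = Qfrac f k.
Proof.
elim/Localization.fracW: q => f [s sP]; have /asboolP[k sE] := sP; exists f, k.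
congr (Localization.frac _ _); exact: val_inj.
Qed.

Lemma QfracM f k g l : Qfrac f k * Qfrac g l = Qfrac (f * g) (k + l).
Proof.
rewrite [LHS]Localization.fracM; congr (Localization.frac _ _); apply: val_inj.
by rewrite /= exprD.
Qed.

Lemma Qfrac_widen j f k : Qfrac f k = Qfrac (f * x0 ^+ j) (k + j).
Proof.
apply/Localization.eq_fracP; exists (Localization.one_den _).
by rewrite /= exprD; ring.
Qed.

Lemma QfracD f g k : Qfrac f k + Qfrac g k = Qfrac (f + g) k.
Proof.
rewrite [LHS]Localization.fracD.
by apply/Localization.eq_fracP; exists (Localization.one_den _) => /=; ring.
Qed.

Lemma QfracN f k : - Qfrac f k = Qfrac (- f) k.
Proof. exact: Localization.fracN. Qed.

Lemma Qfrac_common q r : exists f g k, q = Qfrac f k /\ r = Qfrac g k.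
Proof.
have [f [k ->]] := QfracW q; have [g [l ->]] := QfracW r.
exists (f * x0 ^+ l), (g * x0 ^+ k), (k + l)%N; split; first exact: Qfrac_widen.
by rewrite addnC; exact: Qfrac_widen.
Qed.

Lemma Qinj_zmod_morphism : zmod_morphism Qinj.
Proof. by move=> f g; rewrite /Qinj /= QfracN QfracD. Qed.

Lemma Qinj_monoid_morphism : monoid_morphism Qinj.
Proof.
split; last by move=> f g; rewrite /Qinj QfracM.
by congr (Localization.frac _ _); exact: val_inj.
Qed.

HB.instance Definition _ := GRing.isZmodMorphism.Build R Q Qinj
  Qinj_zmod_morphism.
HB.instance Definition _ := GRing.isMonoidMorphism.Build R Q Qinj
  Qinj_monoid_morphism.

Definition Qscalar : {rmorphism K -> Q} := Qinj \o ga_scalar R.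

Lemma QfracE f k : Qfrac f k = Qfrac 1 k * Qinj f.
Proof. by rewrite QfracM mul1r addn0. Qed.

Lemma Qfrac0 k : Qfrac 0 k = 0.
Proof. by rewrite QfracE rmorph0 mulr0. Qed.

End QhRing.

Section QhGrading.
Variables (K : fieldType) (R : graded_algebra K) (x0 : R).
Local Notation R_ := (ga_deg R).
Local Notation Q := (Qh x0).
Local Notation Qfrac := (Qfrac x0).
Local Notation Qinj := (Qinj x0).
Local Notation Q_ := (@Qh_deg K R x0).
Local Notation Qscalar := (Qscalar x0).
Local Notation Rdec := (@ga_decomposition K R).
Local Notation RB := (@ga_degB K R).
Local Notation RM := (@ga_degM K R).
Hypothesis x0_deg : R_ 1 x0.
Hypothesis x0_nzd : forall f, x0 * f = 0 -> f = 0.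

Lemma x0X_deg k : R_ (Posz k) (x0 ^+ k).
Proof.
elim: k => [|k IH]; first exact: ga_deg1.
by rewrite exprS -[k.+1]add1n PoszD; exact: ga_degM.
Qed.

Lemma x0X_nzd k f : x0 ^+ k * f = 0 -> f = 0.
Proof. by elim: k => [|k IH]; rewrite ?mul1r // exprS -mulrA => /x0_nzd. Qed.

Lemma eq_Qfrac f k g l : Qfrac f k = Qfrac g l <-> f * x0 ^+ l = g * x0 ^+ k.
Proof.
split=> [/Localization.eq_fracP[[u /= /asboolP[j ->]]] H|H].
  by apply/eqP; rewrite -subr_eq0; apply/eqP/(@x0X_nzd j); rewrite mulrBr H subrr.
by apply/Localization.eq_fracP; exists (Localization.one_den _); rewrite /= H.
Qed.

Lemma Qinj_inj : injective Qinj.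
Proof. by move=> f g /eq_Qfrac; rewrite !mulr1. Qed.

Lemma Qscalar_inj : injective Qscalar.
Proof. by move=> c d /Qinj_inj/fmorph_inj. Qed.

Lemma pc_x0X i k f : pc i (f * x0 ^+ k) = pc (i - k%:Z) f * x0 ^+ k.
Proof. exact: (compMr Rdec RB RM i f (x0X_deg k)). Qed.

Lemma Q_frac i f k : R_ (i + k%:Z) f -> Q_ i (Qfrac f k).
Proof. by exists f, k. Qed.

Lemma Q_inj i f : R_ i f -> Q_ i (Qinj f).
Proof. by move=> fi; apply: Q_frac; rewrite addr0. Qed.

Lemma QB i q r : Q_ i q -> Q_ i r -> Q_ i (q - r).
Proof.
move=> [f [k [fi ->]]] [g [l [gi ->]]].
rewrite (Qfrac_widen x0 l f) (Qfrac_widen x0 k g) [(l + k)%N]addnC QfracN QfracD.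
apply: Q_frac; rewrite PoszD addrA; apply: ga_degB.
  by apply: ga_degM => //; exact: x0X_deg.
by rewrite addrAC; apply: ga_degM => //; exact: x0X_deg.
Qed.

Lemma QM i j q r : Q_ i q -> Q_ j r -> Q_ (i + j) (q * r).
Proof.
move=> [f [k [fi ->]]] [g [l [gi ->]]]; rewrite QfracM; apply: Q_frac.
by rewrite PoszD addrACA; exact: ga_degM.
Qed.

(** Components are taken on numerators; comparing components in [f x_0^l = g x_0^k] shows
    independence of the chosen fraction. *)
Lemma Q_comp_exists i (q : Q) : exists r, forall f k, q = Qfrac f k ->
  r = Qfrac (pc (i + k%:Z) f) k.
Proof.
have [f [k ->]] := QfracW q; exists (Qfrac (pc (i + k%:Z) f) k) => g l.
move=> /eq_Qfrac fg; apply/eq_Qfrac.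
have := congr1 (pc (i + k%:Z + l%:Z)) fg; rewrite pc_x0X addrK => ->.
by rewrite pc_x0X addrAC addrK.
Qed.

Lemma Qdec q : exists! u, homog_decomposition Q_ q u.
Proof.
pose c i r := projT1 (cid (Q_comp_exists i r)).
have c_frac i f k : c i (Qfrac f k) = Qfrac (pc (i + k%:Z) f) k.
  exact: (projT2 (cid (Q_comp_exists i _))).
have c_homog i j r : Q_ j r -> c i r = if i == j then r else 0.
  move=> [f [k [fj ->]]]; rewrite c_frac /pc (comp_homog Rdec RB _ fj).
  rewrite (inj_eq (addIr _)); case: eqP => // _.
  exact: Qfrac0.
have c0 i : c i 0 = 0.
  by rewrite -(Qfrac0 x0 0) c_frac /pc comp0 //; exact: RB.
have cD i : {morph c i : r s / r + s}.
  move=> r s; have [f [g [k [-> ->]]]] := Qfrac_common r s.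
  by rewrite QfracD !c_frac QfracD /pc compD //; exact: RB.
exists (c ^~ q); split.
- split=> [i|].
    have [f [k ->]] := QfracW q; rewrite c_frac; apply: Q_frac; exact: comp_deg.
  have [f [k ->]] := QfracW q; have [s [us s0 sE]] := comp_support Rdec f.
  exists [seq j - k%:Z | j <- s]; split=> [|i is_|].
  + by rewrite map_inj_uniq //; exact: addIr.
  + rewrite c_frac /pc s0; first exact: Qfrac0.
    by apply: contra is_ => is_; apply/mapP; exists (i + k%:Z); rewrite ?addrK.
  + rewrite big_map; under eq_bigr do rewrite c_frac subrK QfracE.
    by rewrite -mulr_sumr -rmorph_sum -sE -QfracE.
- move=> u [hu [s [us s0 ->]]]; apply/funext => i.
  rewrite (big_morph (c i) (cD i) (c0 i)).
  under eq_bigr => j _ do rewrite (c_homog _ _ _ (hu j)).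
  rewrite -big_mkcond; have [is_|/[dup] is_ /s0->] := boolP (i \in s).
    rewrite (big_rem _ is_) /= eqxx big_seq_cond big1 ?addr0 // => j.
    rewrite mem_rem_uniq // !inE -andbA => /and3P[ji _ /eqP ij].
    by rewrite ij eqxx in ji.
  by rewrite big_seq_cond big1 // => j /andP[js /eqP ij]; rewrite ij js in is_.
Qed.

Definition qc := hcomp Qdec.

Lemma qc_deg i q : Q_ i (qc i q). Proof. exact: comp_deg. Qed.
Lemma qc_homog i j q : Q_ j q -> qc i q = if i == j then q else 0.
Proof. by apply: comp_homog; exact: QB. Qed.
Lemma qc0 i : qc i 0 = 0. Proof. by apply: comp0; exact: QB. Qed.
Lemma qcD i q r : qc i (q + r) = qc i q + qc i r.
Proof. by apply: compD; exact: QB. Qed.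
Lemma qcM i j q r : Q_ j r -> qc i (q * r) = qc (i - j) q * r.
Proof. by apply: compMr; [exact: QB|exact: QM]. Qed.
Lemma Q0 i : Q_ i 0. Proof. by apply: homog0; [exact: Qdec|exact: QB]. Qed.
Lemma QD i q r : Q_ i q -> Q_ i r -> Q_ i (q + r).
Proof. by apply: homogD; [exact: Qdec|exact: QB]. Qed.
Lemma qc_inj i f : qc i (Qinj f) = Qinj (pc i f).
Proof.
apply: (comp_uniq Qdec (u := fun i => Qinj (pc i f))); split=> [j|].
  by apply: Q_inj; exact: comp_deg.
have [s [us s0 sE]] := comp_support Rdec f; exists s; split=> // [j js|].
  by rewrite /pc s0 // rmorph0.
by rewrite -rmorph_sum -sE.
Qed.

Lemma Q_inj_deg i f : Q_ i (Qinj f) -> R_ i f.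
Proof.
move=> fi; have := qc_homog i fi; rewrite eqxx qc_inj => /Qinj_inj<-.
exact: comp_deg.
Qed.

Lemma Q_scalar c : Q_ 0 (Qscalar c).
Proof. by apply: Q_inj; exact: ga_deg_scalar. Qed.

Lemma Q_subspace i : subspace Qscalar (Q_ i).
Proof.
split=> [|c q r qi ri]; first exact: Q0.
by apply: QD => //; rewrite -[i]add0r; apply: QM => //; exact: Q_scalar.
Qed.

(** The power [x_0^i] for an arbitrary integer [i]. *)
Definition xpow (i : int) : Q :=
  match i with Posz m => Qinj (x0 ^+ m) | Negz m => Qfrac 1 m.+1 end.

Lemma xpowE m l : Qfrac (x0 ^+ m) l = xpow (m%:Z - l%:Z).
Proof.
have [ml|lm] := leqP l m.
  by rewrite subzn //=; apply/eq_Qfrac; rewrite mulr1 -exprD subnK.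
have -> : m%:Z - l%:Z = Negz (l - m).-1 by lia.
by apply/eq_Qfrac; rewrite prednK ?subn_gt0 // -exprD subnKC ?mul1r // ltnW.
Qed.

Lemma xpow_frac i : exists m l : nat, i = m%:Z - l%:Z.
Proof. by case: i => m; [exists m, 0%N|exists 0%N, m.+1]; lia. Qed.

Lemma xpowD i j : xpow (i + j) = xpow i * xpow j.
Proof.
have [m [l ->]] := xpow_frac i; have [m' [l' ->]] := xpow_frac j.
by rewrite -!xpowE QfracM -exprD xpowE; congr xpow; lia.
Qed.

Lemma xpow0 : xpow 0 = 1. Proof. exact: rmorph1. Qed.

Lemma xpowVK i q : xpow (- i) * (xpow i * q) = q.
Proof. by rewrite mulrA -xpowD addNr xpow0 mul1r. Qed.

Lemma xpowK i q : xpow i * (xpow (- i) * q) = q.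
Proof. by rewrite mulrA -xpowD addrN xpow0 mul1r. Qed.

Lemma xpow_deg i : Q_ i (xpow i).
Proof.
case: i => m /=; first exact/Q_inj/x0X_deg.
by apply: Q_frac; rewrite NegzE addNr; exact: ga_deg1.
Qed.

End QhGrading.

(** * The trace map and the complementary module *)

Section Kx0.
Variables (K : fieldType) (R : graded_algebra K) (x0 : R).

Lemma Kx0_horner (a : {poly K}) :
  (map_poly (ga_scalar R) a).[x0] = \sum_(i < size a) ga_scalar R a`_i * x0 ^+ i.
Proof.
rewrite (@horner_coef_wide _ (size a)) ?size_map_poly //.
by apply: eq_bigr => i _; rewrite coef_map.
Qed.

Lemma Kx0_monomial c k : Kx0 x0 (ga_scalar R c * x0 ^+ k).
Proof.
exists (c%:P * 'X^k); rewrite rmorphM /= map_polyC map_polyXn.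
by rewrite hornerCM hornerXn.
Qed.

Lemma Kx0D f g : Kx0 x0 f -> Kx0 x0 g -> Kx0 x0 (f + g).
Proof. by move=> [a ->] [b ->]; exists (a + b); rewrite rmorphD hornerD. Qed.

Lemma Kx0_0 : Kx0 x0 0.
Proof. by exists 0; rewrite rmorph0 horner0. Qed.

Lemma Kx0_1 : Kx0 x0 1.
Proof. by exists 1; rewrite rmorph1 hornerC. Qed.

End Kx0.

Section Trace.
Variables (K : fieldType) (R : graded_algebra K) (x0 : R).
Local Notation R_ := (ga_deg R).
Local Notation Q := (Qh x0).
Local Notation Qfrac := (Qfrac x0).
Local Notation Qinj := (Qinj x0).
Local Notation Q_ := (@Qh_deg K R x0).
Local Notation Qscalar := (Qscalar x0).
Local Notation xpow := (xpow x0).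
Local Notation L0 := (@L0 K R x0).
Local Notation Rdec := (@ga_decomposition K R).
Local Notation RB := (@ga_degB K R).
Local Notation RM := (@ga_degM K R).
Hypothesis x0_deg : R_ 1 x0.
Hypothesis x0_nzd : forall f, x0 * f = 0 -> f = 0.
Hypothesis R_neg : forall i f, i < 0 -> R_ i f -> f = 0.
Variable sigma : Q -> Q.
Hypothesis trace_sigma : trace_map sigma.
Local Notation qc := (qc x0_deg x0_nzd).
Local Notation CX := (complementary_module sigma).

Lemma Kx0_pc i f : Kx0 x0 f -> exists c, Qinj (pc i f) = Qscalar c * xpow i.
Proof.
move=> [a ->]; rewrite Kx0_horner /pc; case: i => [k|k]; last first.
  by exists 0; rewrite (R_neg _ (comp_deg Rdec _ _)) // rmorph0 rmorph0 mul0r.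
exists a`_k; rewrite comp_sum; last exact: RB.
rewrite -[RHS](rmorphM Qinj); congr Qinj.
under eq_bigr => i _ do
  rewrite mulrC (compMr Rdec RB RM _ _ (ga_deg_scalar _ _))
    subr0 (comp_homog Rdec RB _ (x0X_deg x0_deg i)) eqz_nat.
have [ka|ak] := ltnP k (size a).
  rewrite (bigD1 (Ordinal ka)) //= eqxx big1 ?addr0 1?mulrC // => i ik.
  by case: eqP => [kE|_]; rewrite ?mul0r //; case/eqP: ik; exact: val_inj.
rewrite nth_default // rmorph0 mul0r big1 // => i _.
by case: eqP => [kE|_]; rewrite ?mul0r //; move: (ltn_ord i); rewrite -kE ltnNge ak.
Qed.

Lemma L0_homog i q : L0 q -> Q_ i q -> exists c, q = Qscalar c * xpow i.
Proof.
move=> [f [k [Kf ->]]] qi; have [c cE] := Kx0_pc (i + k%:Z) Kf; exists c.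
have := qc_homog x0_deg x0_nzd i qi; rewrite eqxx => <-.
rewrite QfracE mulrC (qcM x0_deg x0_nzd _ _ (j := - k%:Z)); last first.
  by apply: Q_frac; rewrite addNr; exact: ga_deg1.
rewrite opprK qc_inj cE xpowD // -!mulrA; congr (_ * _).
rewrite -[Qfrac 1 k](_ : xpow (- k%:Z) = _); last first.
  by rewrite -[- _]add0r -(xpowE x0_nzd 0%N k).
by rewrite -xpowD // addrN xpow0 mulr1.
Qed.

Lemma L0_xpow i : L0 (xpow i).
Proof.
case: i => m /=; [exists (x0 ^+ m), 0%N|exists 1, m.+1]; split=> //.
  by rewrite -[x0 ^+ m]mul1r -(rmorph1 (ga_scalar R)); exact: Kx0_monomial.
exact: Kx0_1.
Qed.

Lemma L0_Qinj f : Kx0 x0 f -> L0 (Qinj f).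
Proof. by move=> Kf; exists f, 0%N. Qed.

Lemma L0_scalar c : L0 (Qscalar c).
Proof.
by apply: L0_Qinj; rewrite -[ga_scalar R c]mulr1 -(expr0 x0); exact: Kx0_monomial.
Qed.

Lemma sigmaL b q r : L0 b -> sigma (b * q + r) = b * sigma q + sigma r.
Proof. by have [[sL _ _] _] := trace_sigma; move=> /sL. Qed.

Lemma sigmaD q r : sigma (q + r) = sigma q + sigma r.
Proof.
by have := sigmaL q r (L0_scalar 1); rewrite rmorph1 !mul1r.
Qed.

Lemma sigma0 : sigma 0 = 0.
Proof. by apply: (addrI (sigma 0)); rewrite -sigmaD !addr0. Qed.

Lemma sigmaM b q : L0 b -> sigma (b * q) = b * sigma q.
Proof. by move=> Lb; have := sigmaL q 0 Lb; rewrite sigma0 !addr0. Qed.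

Lemma sigmaB q r : sigma (q - r) = sigma q - sigma r.
Proof.
rewrite -[- r]mulN1r -(rmorphN1 Qscalar) sigmaD sigmaM; last exact: L0_scalar.
by rewrite rmorphN1 mulN1r.
Qed.

Lemma sigma_deg i q : Q_ i q -> Q_ i (sigma q).
Proof. by have [[_ _ sd] _] := trace_sigma; move=> /sd; rewrite addr0. Qed.

Lemma sigma_sum (I : Type) (s : seq I) (P : pred I) (F : I -> Q) :
  sigma (\sum_(i <- s | P i) F i) = \sum_(i <- s | P i) sigma (F i).
Proof. by apply: big_morph; [exact: sigmaD|exact: sigma0]. Qed.

Lemma qc_sigma i q : qc i (sigma q) = sigma (qc i q).
Proof.
have [s [us s0 sE]] := comp_support (Qdec x0_deg x0_nzd) q.
rewrite {1}sE sigma_sum /qc comp_sum; last exact: QB.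
under eq_bigr => j _ do
  rewrite (comp_homog _ (QB x0_deg) i (sigma_deg (comp_deg _ j q))).
rewrite -big_mkcond; have [i_s|/[dup] i_s /s0 ->] := boolP (i \in s).
  rewrite (big_rem _ i_s) /= eqxx big_seq_cond big1 ?addr0 // => j.
  by rewrite mem_rem_uniq // !inE -andbA => /and3P[/negPf ji _]; rewrite eq_sym ji.
rewrite sigma0 big_seq_cond big1 // => j /andP[js /eqP ij].
by rewrite ij js in i_s.
Qed.

Lemma sigma_scalar q : exists c, qc 0 (sigma q) = Qscalar c.
Proof.
have [[_ sL _] _] := trace_sigma.
have [|c] := L0_homog (i := 0) (sL (qc 0 q)); first exact/sigma_deg/qc_deg.
by rewrite -qc_sigma => ->; exists c; rewrite xpow0 mulr1.
Qed.

(** The trace form: on elements of degree 0 it is [sigma] with its values read in [K]. *)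
Definition tau (q : Q) : K := projT1 (cid (sigma_scalar q)).

Lemma tau_sigma q : qc 0 (sigma q) = Qscalar (tau q).
Proof. exact: (projT2 (cid (sigma_scalar q))). Qed.

Lemma tauE q : Q_ 0 q -> sigma q = Qscalar (tau q).
Proof.
move=> q0; rewrite -tau_sigma.
by rewrite (qc_homog x0_deg x0_nzd 0 (sigma_deg q0)).
Qed.

Lemma tauL c q r : tau (Qscalar c * q + r) = c * tau q + tau r.
Proof.
apply: (Qscalar_inj x0_nzd); rewrite rmorphD rmorphM -!tau_sigma.
rewrite (sigmaL _ _ (L0_scalar c)) qcD //; congr (_ + _).
by rewrite mulrC (qcM x0_deg x0_nzd _ _ (Q_scalar x0 c)) subr0 mulrC.
Qed.

(** Both [h] and 0 represent the zero map, and the representing element is unique. *)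
Lemma sigma_nondegenerate h : (forall q, sigma (h * q) = 0) -> h = 0.
Proof.
move=> h0; have [_ /(_ (fun=> 0))[]] := trace_sigma.
  exists (fun _ _ => 0); split=> [d|]; last by exists [::] => f; rewrite big_nil.
  split=> [b _ f g|_|i f _]; first by rewrite mulr0 addr0.
    by rewrite -(rmorph0 Qinj); apply: L0_Qinj; exact: Kx0_0.
  exact: Q0.
move=> g [_ gu]; rewrite -(gu h); last by move=> q; rewrite h0.
by apply: gu => q; rewrite mul0r sigma0.
Qed.

(** One degree suffices as a test, since [sigma] is [L0]-linear and powers of [x_0] move any degree
    to any other. *)
Lemma sigma_nondegenerate_deg i h :
  (forall q, Q_ i q -> sigma (h * q) = 0) -> h = 0.
Proof.
move=> h0; apply: sigma_nondegenerate => q.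
have [s [us s0 ->]] := comp_support (Qdec x0_deg x0_nzd) q.
rewrite mulr_sumr sigma_sum big1 // => j _.
rewrite -(xpowK x0_nzd (j - i) (hcomp _ _ _)) mulrCA.
rewrite (sigmaM _ (L0_xpow _)) h0 ?mulr0 //.
rewrite -[X in Q_ X](_ : - (j - i) + j = _) ; last by rewrite opprB subrK.
by apply: QM => //; [exact: xpow_deg|exact: comp_deg].
Qed.

(* An element of L_0 of degree d lies in K[x_0] iff d >= 0 or it vanishes. *)
Lemma CX_equivalences g :
  [/\ CX g -> forall f, exists y, sigma (g * Qinj f) = Qinj y,
      (forall f, exists y, sigma (g * Qinj f) = Qinj y) ->
        forall i j f, R_ i f -> i + j < 0 -> sigma (qc j g * Qinj f) = 0
    & (forall i j f, R_ i f -> i + j < 0 -> sigma (qc j g * Qinj f) = 0) -> CX g].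
Proof.
split.
- by move=> [phi _ phiE] f; exists (phi f); exact: phiE.
- move=> gR i j f fi ij; have [y yE] := gR f.
  have := qcM x0_deg x0_nzd (i + j) g (Q_inj x0 fi); rewrite addrAC addrN add0r => <-.
  rewrite -qc_sigma yE qc_inj -[RHS](rmorph0 Qinj); congr Qinj.
  by apply: R_neg ij _; exact: comp_deg.
- move=> g0.
  have H d f : exists y, Kx0 x0 y /\ sigma (qc d g * Qinj f) = Qinj y.
    have [s [_ _ ->]] := comp_support Rdec f.
    rewrite rmorph_sum mulr_sumr sigma_sum.
    apply: (big_ind (fun q => exists y, Kx0 x0 y /\ q = Qinj y)).
    + by exists 0; split; [exact: Kx0_0|rewrite rmorph0].
    + move=> _ _ [y [Ky ->]] [z [Kz ->]]; exists (y + z).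
      by split; [exact: Kx0D|rewrite rmorphD].
    + move=> i _; have fi := comp_deg Rdec i f.
      have [id0|id0] := ltP (i + d) 0.
        by exists 0; split; [exact: Kx0_0|rewrite (g0 i d) // rmorph0].
      have [[_ sL _] _] := trace_sigma.
      have [|c ->] := L0_homog (i := d + i) (sL (qc d g * Qinj (hcomp Rdec i f))).
        by apply: sigma_deg; apply: QM => //; [exact: qc_deg|exact: Q_inj].
      move: id0; rewrite addrC; case: (d + i) => // m _.
      exists (ga_scalar R c * x0 ^+ m); split; first exact: Kx0_monomial.
      by rewrite rmorphM.
  have /choice[phi phiP] (df : int * R) := H df.1 df.2.
  have [s [_ _ gE]] := comp_support (Qdec x0_deg x0_nzd) g.
  (* The component of [g] of degree [d] contributes the homogeneous piece of degree [d] of the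
     required map. *)
  exists (fun f => \sum_(d <- s) phi (d, f)).
    exists (fun d f => phi (d, f)); split; last by exists s.
    move=> d; split=> [b Kb f h|f|i f fi]; cbv beta; last 2 first.
    + exact: (phiP (d, f)).1.
    + apply: (Q_inj_deg x0_deg x0_nzd); rewrite -(phiP (d, f)).2 addrC.
      by apply: sigma_deg; apply: QM => //; [exact: qc_deg|exact: Q_inj].
    + apply: (Qinj_inj x0_nzd); rewrite -(phiP (d, _)).2.
      transitivity (Qinj b * sigma (qc d g * Qinj f) + sigma (qc d g * Qinj h)).
        by rewrite -(sigmaL _ _ (L0_Qinj Kb)) rmorphD rmorphM; congr sigma; ring.
      by rewrite (phiP (d, f)).2 (phiP (d, h)).2 -rmorphM -rmorphD.
  move=> f k; rewrite QfracE mulrCA sigmaM; last by exists 1, k; split; [exact: Kx0_1|].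
  rewrite [RHS]QfracE; congr (_ * _); rewrite {1}gE mulr_suml sigma_sum rmorph_sum.
  apply: eq_bigr => d _; exact: (phiP (d, f)).2.
Qed.

Lemma CXP g : CX g <->
  forall i j f, R_ i f -> i + j < 0 -> sigma (qc j g * Qinj f) = 0.
Proof. by have [H1 H2 H3] := CX_equivalences g; split=> [/H1/H2|/H3]. Qed.

(** The criterion that [sigma] maps [g R] into [R] is stable under [R]-linear combinations. *)
Lemma CX_subspace a g h : CX g -> CX h -> CX (Qinj a * g + h).
Proof.
have [gH _ _] := CX_equivalences g; have [hH _ _] := CX_equivalences h.
have [_ H2 H3] := CX_equivalences (Qinj a * g + h).
move=> /gH{}gH /hH{}hH; apply: H3; apply: H2 => f.
have [y yE] := gH (a * f); have [z zE] := hH f; exists (y + z).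
have -> : Qinj (y + z) = Qinj y + Qinj z by exact: rmorphD.
by rewrite -yE -zE -sigmaD rmorphM; congr sigma; ring.
Qed.

(* The form q |-> tau (a q) on Q^h(R)_0 attached to an element a of degree 0  *)
(* must vanish on x_0^(- r) R_r for x_0^(- r - 1) a to be in C_X; these are   *)
(* dim R_r linear conditions on a.                                            *)
Lemma exists_CX_off_line (r : nat) d m u :
  has_dim Qscalar (Q_ 0) d -> has_dim (ga_scalar R) (R_ r) m -> (m + 2 <= d)%N ->
  exists g, [/\ CX g, Q_ (- r.+1%:Z) g & forall c, g <> Qscalar c * u].
Proof.
move=> Qd /(has_dimP _ (ga_deg_subspace R r))[b Rb [bR _]] md.
pose t i a := tau (a * (xpow (- r%:Z) * Qinj (b i))).
(* The unknown [a] has degree 0, so the line to avoid is multiplied by [x_0^(r+1)] accordingly. *)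
have [|a a0 [ta au]] := exists_solution_off_line (t := t) (xpow r.+1 * u)
  (Q_subspace x0_deg x0_nzd 0) Qd md.
  by move=> i c x y _ _; rewrite /t mulrDl -mulrA tauL.
exists (xpow (- r.+1%:Z) * a); split.
- apply/CXP => i j f fi ij.
  rewrite (qc_homog x0_deg x0_nzd _ (j := - r.+1%:Z)); last first.
    by rewrite -[X in Q_ X]addr0; apply: QM => //; exact: xpow_deg.
  case: eqP => [jE|_]; last by rewrite mul0r sigma0.
  have {ij} ir : i <= r by move: ij; rewrite jE; lia.
  case: i fi ir => [i|i] fi ir; last by rewrite (R_neg _ fi) // rmorph0 mulr0 sigma0.
  have {}ir : (i <= r)%N by [].
  (* Multiplied by a power of [x_0], any [f] of degree at most [r] lands in degree [r], where the
     conditions on the basis [b] apply. *)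
  have [|c fE] := bR (f * x0 ^+ (r - i)).
    rewrite -[X in R_ (Posz X)](subnKC ir) PoszD; apply: ga_degM => //.
    exact: x0X_deg.
  have af0 : sigma (a * (xpow (- r%:Z) * Qinj (f * x0 ^+ (r - i)))) = 0.
    rewrite fE /lincomb rmorph_sum !mulr_sumr sigma_sum big1 // => k _.
    rewrite rmorphM (_ : a * _ = Qscalar (c 0 k) *
      (a * (xpow (- r%:Z) * Qinj (b k)))) /=; last by ring.
    rewrite sigmaM; last exact: L0_scalar.
    rewrite tauE; first by rewrite -/(t k a) ta rmorph0 mulr0.
    rewrite -[X in Q_ X](_ : 0 + (- r%:Z + r) = _); last by rewrite addNr.
    exact: QM a0 (QM (xpow_deg x0_deg _) (Q_inj x0 (Rb k))).
  rewrite -(xpowVK x0_nzd (r - i)%:Z (sigma _)) -sigmaM; last exact: L0_xpow.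
  rewrite (_ : xpow (r - i)%:Z * _ = xpow (- 1) *
    (a * (xpow (- r%:Z) * Qinj (f * x0 ^+ (r - i))))).
    by rewrite sigmaM ?af0 ?mulr0 //; exact: L0_xpow.
  have -> : Qinj (f * x0 ^+ (r - i)) = Qinj f * xpow (r - i)%:Z by exact: rmorphM.
  have -> : - r.+1%:Z = - 1 + - r%:Z by lia.
  by rewrite xpowD //; ring.
- by rewrite -[X in Q_ X]addr0; apply: QM => //; exact: xpow_deg.
- move=> c gE; apply: (au c); rewrite mulrCA -gE xpowK //.
Qed.

End Trace.

(** * Regularity index *)

Section ZmodSubtype.
Variables (V : zmodType) (S : zmodClosed V).

Definition zmod_sub := {x : V | x \in S}.
HB.instance Definition _ := SubType.on zmod_sub.
HB.instance Definition _ := Choice.on zmod_sub.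
HB.instance Definition _ := [SubChoice_isSubZmodule of zmod_sub by <:].

End ZmodSubtype.

(** [almost_gorenstein] wants its cokernel as an [lmodType]; this turns a set with an action into
    one. *)
Lemma exists_submodule (R : pzRingType) (V : zmodType) (S : set V)
    (act : R -> V -> V) :
  S 0 -> (forall x y, S x -> S y -> S (x - y)) ->
  (forall a x, S x -> S (act a x)) ->
  (forall a b x, S x -> act a (act b x) = act (a * b) x) ->
  (forall x, S x -> act 1 x = x) ->
  (forall a x y, S x -> S y -> act a (x + y) = act a x + act a y) ->
  (forall a b x, S x -> act (a + b) x = act a x + act b x) ->
  exists (C : lmodType R) (inc : C -> V),
    [/\ injective inc, forall c, S (inc c), forall x, S x -> exists c, inc c = x,
        forall a c, inc (a *: c) = act a (inc c)
      & forall c d, inc (c + d) = inc c + inc d].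
Proof.
move=> S0 SB actS actA act1 actDr actDl.
pose P : V -> bool := fun x => `[< S x >].
have PB : zmod_closed P.
  split; first exact/asboolP.
  by move=> x y /asboolP Sx /asboolP Sy; apply/asboolP/SB.
pose zS : zmodClosed V := HB.pack P (GRing.isZmodClosed.Build V P PB).
pose T := zmod_sub zS.
have TS (c : T) : S (val c) by exact/asboolP/(valP c).
have mkT x : S x -> x \in zS by move=> Sx; apply/asboolP.
pose scale a (c : T) : T := exist _ (act a (val c)) (mkT _ (actS a _ (TS c))).
have sA a b c : scale a (scale b c) = scale (a * b) c.
  by apply: val_inj; exact: actA.
have s1 : left_id 1 scale by move=> c; apply: val_inj; exact: act1.
have sDr : right_distributive scale +%R.
  by move=> a c d; apply: val_inj; exact: actDr.
have sDl c : {morph scale^~ c : a b / a + b}.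
  by move=> a b; apply: val_inj; exact: actDl.
pose C : lmodType R := HB.pack T
  (GRing.Zmodule_isLmodule.Build R T sA s1 sDr sDl).
exists C, (fun c : C => val (c : T)); split=> //.
- exact: val_inj.
- by move=> x Sx; exists (exist _ x (mkT x Sx)).
Qed.

(** * Comparison of [R] and [Qh x0] beyond the regularity index, and the socle element *)

Section Main.
Variables (K : fieldType) (R : graded_algebra K) (x0 : R).
Local Notation R_ := (ga_deg R).
Local Notation Q := (Qh x0).
Local Notation Qinj := (Qinj x0).
Local Notation Q_ := (@Qh_deg K R x0).
Local Notation Qscalar := (Qscalar x0).
Local Notation xpow := (xpow x0).
Local Notation Rdec := (@ga_decomposition K R).
Local Notation RB := (@ga_degB K R).
Local Notation RM := (@ga_degM K R).
Hypothesis x0_deg : R_ 1 x0.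
Hypothesis x0_nzd : forall f, x0 * f = 0 -> f = 0.
Hypothesis R_neg : forall i f, i < 0 -> R_ i f -> f = 0.
Hypothesis has_dim_HF : forall i, has_dim (ga_scalar R) (R_ i) (HF R i).
Variable sigma : Q -> Q.
Hypothesis trace_sigma : trace_map sigma.
Local Notation qc := (qc x0_deg x0_nzd).
Local Notation CX := (complementary_module sigma).
Local Notation D := (proj_degree R).

Lemma pc_mull_homog i j f g : R_ j f -> pc i (f * g) = f * pc (i - j) g.
Proof. by move=> fj; rewrite mulrC /pc (compMr Rdec RB RM _ _ fj) mulrC. Qed.

Section Regularity.
Variable r : nat.
Hypothesis reg_r : is_regularity_index R r.

(** Multiplication by [x_0] is injective between two spaces of the same dimension [deg X]. *)
Lemma x0_surjective i f : r%:Z <= i -> R_ (i + 1) f ->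
  exists2 g, R_ i g & f = g * x0.
Proof.
move=> ri fi.
have [| | |_ H] := has_dim_inj (f := fun g => g * x0) (ga_deg_subspace R i)
  (ga_deg_subspace R (i + 1)) _ _ _ (has_dim_HF i) (has_dim_HF (i + 1)).
- by move=> g gi; exact: ga_degM.
- by move=> c g h _ _; ring.
- by move=> g _; rewrite mulrC => /x0_nzd.
have [|g gi <-] := H _ _ fi; last by exists g.
by rewrite !reg_r.1 //; lia.
Qed.

(** The factors [x_0] of the denominator cancel one at a time by [x0_surjective]. *)
Lemma Q_Qinj i q : r%:Z <= i -> Q_ i q -> exists2 f, R_ i f & q = Qinj f.
Proof.
move=> ri [f [k [fi ->]]]; elim: k f fi => [|k IH] f fi.
  by exists f => //; rewrite addr0 in fi.
have [||g gi ->] := @x0_surjective (i + k%:Z) f; first by lia.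
  by rewrite (_ : i + k + 1 = i + k.+1%:Z) //; lia.
have [h hi hE] := IH g gi; exists h => //; rewrite -hE.
by apply/(eq_Qfrac x0_nzd); rewrite exprS mulrA.
Qed.

Lemma has_dim_Q0 : has_dim Qscalar (Q_ 0) D.
Proof.
have <- := reg_r.1 _ (lexx _).
apply: (has_dim_bij (f := fun f => xpow (- r%:Z) * Qinj f)
  (ga_deg_subspace R r) (Q_subspace x0_deg x0_nzd 0) _ _ _ (has_dim_HF r)).
- move=> f fr; rewrite -(addNr r%:Z).
  by apply: QM; [exact: xpow_deg|exact: Q_inj].
- by move=> c f g _ _; rewrite rmorphD rmorphM /=; ring.
- move=> f _ /(congr1 ( *%R (xpow r))); rewrite (xpowK x0_nzd) mulr0.
  by rewrite -[RHS](rmorph0 Qinj) => /(Qinj_inj x0_nzd).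
- move=> q q0; have [|f fr fE] := @Q_Qinj r (xpow r * q) (lexx _).
    by rewrite -[X in Q_ X]addr0; apply: QM => //; exact: xpow_deg.
  by exists f => //; rewrite -fE (xpowVK x0_nzd).
Qed.

End Regularity.

Lemma Qinj_components q : (forall i, exists f, qc i q = Qinj f) ->
  exists f, q = Qinj f.
Proof.
move=> qR; have [s [_ _ qE]] := comp_support (Qdec x0_deg x0_nzd) q.
rewrite qE; apply: (big_ind (fun q => exists f, q = Qinj f)).
- by exists 0; rewrite rmorph0.
- by move=> _ _ [f ->] [g ->]; exists (f + g); rewrite rmorphD.
- by move=> i _; exact: qR.
Qed.

Lemma CX0 : CX 0.
Proof.
apply/(CXP x0_deg x0_nzd R_neg trace_sigma) => *.
by rewrite qc0 mul0r (sigma0 trace_sigma).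
Qed.

Lemma CXM a g : CX g -> CX (Qinj a * g).
Proof.
move=> Cg; rewrite -[_ * _]addr0.
exact: (CX_subspace x0_deg x0_nzd R_neg trace_sigma a Cg CX0).
Qed.

Lemma irrelevant_deg i f : 1 <= i -> R_ i f -> irrelevant_ideal R f.
Proof.
move=> i1 fi; exists (fun i => pc i f); first exact: comp_decomposition.
move=> j j1; rewrite /pc (comp_homog Rdec RB _ fi); case: eqP => // jE.
by move: j1; rewrite jE ltNge i1.
Qed.

Lemma irrelevant_pc i f : i < 1 -> irrelevant_ideal R f -> pc i f = 0.
Proof. by move=> i1 [u uf u0]; rewrite /pc (comp_uniq Rdec uf) u0. Qed.

(* If g is a second element of C_X of degree - r then x_0 g = l u for some l  *)
(* of degree 1, and m g <= R u shows that the class of l modulo x_0 is killed *)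
(* by the maximal ideal.                                                      *)
Lemma almost_gorenstein_socle (r : nat) :
  regularity_index R = r.+1%:Z -> is_regularity_index R r.+1%:Z ->
  (HF R r + 2 <= D)%N -> almost_gorenstein sigma ->
  exists l, [/\ R_ 1 l, forall c, l <> ga_scalar R c * x0
    & forall m, irrelevant_ideal R m -> exists f, m * l = f * x0].
Proof.
move=> rE reg_r rD [C [C_ [alpha [beta [_ [alphaL alphaC alpha_deg] [betaL _]
  [alpha_inj beta_ker _] mC]]]]].
have alpha0 : alpha 0 = 0.
  have := alphaL 0 1 0; rewrite mul0r addr0 rmorph0 mul0r add0r.
  by have := alphaL 1 0 0; rewrite mulr0 addr0 rmorph1 mul1r => /esym/eqP;
    rewrite -subr_eq0 addrK => /eqP->.
have beta0 : beta 0 = 0.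
  have := betaL 1 0 0 CX0 CX0; rewrite mulr0 addr0 scale1r => /esym/eqP.
  by rewrite -subr_eq0 addrK => /eqP.
have alphaE f : alpha f = Qinj f * alpha 1.
  by have := alphaL f 1 0; rewrite mulr1 addr0 alpha0 addr0.
set u := alpha 1 in alphaE.
have u_deg : Q_ (- r.+1%:Z) u.
  by rewrite -[- _]add0r -rE; apply: alpha_deg; exact: ga_deg1.
have [g [Cg g_deg gu]] := exists_CX_off_line x0_deg x0_nzd R_neg trace_sigma u
  (has_dim_Q0 reg_r) (has_dim_HF r) rD.
(* [beta (m g) = m beta g = 0], so exactness puts [m g] into the image [R u] of [alpha]. *)
have mg m : irrelevant_ideal R m -> exists f, Qinj m * g = Qinj f * u.
  move=> mI; have [|f] := (beta_ker _ (CXM m Cg)).1.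
    by have := betaL m g 0 Cg CX0; rewrite !addr0 beta0 addr0 mC.
  by rewrite alphaE; exists f.
have [l' l'E] := mg x0 (irrelevant_deg (lexx _) x0_deg).
(* [l'] may be inhomogeneous, but comparing degrees leaves only its component of degree 1. *)
have lE : Qinj x0 * g = Qinj (pc 1 l') * u.
  have x0g : Q_ (1 - r.+1%:Z) (Qinj x0 * g) by apply: QM => //; exact: Q_inj.
  have := qc_homog x0_deg x0_nzd (1 - r.+1%:Z) x0g; rewrite eqxx => <-.
  by rewrite l'E (qcM x0_deg x0_nzd _ _ u_deg) opprK subrK qc_inj.
exists (pc 1 l'); split.
- exact: comp_deg.
- move=> c cE; apply: (gu c).
  rewrite -[g](xpowVK x0_nzd 1) -[RHS](xpowVK x0_nzd 1); congr (_ * _).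
  by rewrite [LHS]lE cE rmorphM /=; ring.
(* [m l u = m x_0 g = x_0 f u], and [alpha] is injective. *)
- move=> m /mg[f fE]; exists f; apply: alpha_inj; rewrite !alphaE !rmorphM /=.
  transitivity (Qinj m * (Qinj (pc 1 l') * u)); first by ring.
  by rewrite -lE mulrCA fE; ring.
Qed.

End Main.

(** * Regularity index 1 *)

Section RegularityOne.
Variables (K : fieldType) (R : graded_algebra K) (x0 : R).
Local Notation R_ := (ga_deg R).
Local Notation Q := (Qh x0).
Local Notation Qinj := (Qinj x0).
Local Notation Q_ := (@Qh_deg K R x0).
Local Notation Qscalar := (Qscalar x0).
Local Notation xpow := (xpow x0).
Local Notation Rdec := (@ga_decomposition K R).
Local Notation RB := (@ga_degB K R).
Local Notation RM := (@ga_degM K R).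
Hypothesis x0_deg : R_ 1 x0.
Hypothesis x0_nzd : forall f, x0 * f = 0 -> f = 0.
Hypothesis R_neg : forall i f, i < 0 -> R_ i f -> f = 0.
Hypothesis R0_scalar : forall f, R_ 0 f -> exists c, f = ga_scalar R c.
Hypothesis has_dim_HF : forall i, has_dim (ga_scalar R) (R_ i) (HF R i).
Variable sigma : Q -> Q.
Hypothesis trace_sigma : trace_map sigma.
Local Notation qc := (qc x0_deg x0_nzd).
Local Notation CX := (complementary_module sigma).
Local Notation D := (proj_degree R).
Local Notation tau := (tau x0_deg x0_nzd R_neg trace_sigma).

Hypothesis infK : infinite_set [set: K].
Hypothesis HF0 : HF R 0 = 1%N.
Hypothesis reg1 : is_regularity_index R 1%N%:Z.

(** If [R_1] were [K x_0], then [HF] would already be constant from degree 0 on, against the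
    minimality of the index 1. *)
Lemma exists_deg1 : exists2 h, R_ 1 h & forall c, h <> ga_scalar R c * x0.
Proof.
apply: contrapT => nex.
have HF1 : HF R 1 = 1%N.
  apply: (has_dim_uniq (ga_deg_subspace R 1) (has_dim_HF 1)); rewrite -HF0.
  apply: (has_dim_bij (f := fun g => g * x0) (ga_deg_subspace R 0)
    (ga_deg_subspace R 1) _ _ _ (has_dim_HF 0)).
  - by move=> g g0; rewrite -[1]add0r; exact: ga_degM.
  - by move=> c g g' _ _; ring.
  - by move=> g _; rewrite mulrC => /x0_nzd.
  - move=> h h1; have [c hE] : exists c, h = ga_scalar R c * x0.
      by apply: contrapT => nc; apply: nex; exists h => // c hE; apply: nc; exists c.
    by exists (ga_scalar R c); [exact: ga_deg_scalar|rewrite hE].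
suff /reg1.2 : forall i : int, 0 <= i -> HF R i = D by [].
move=> i i0; have [i1|i1] := leP 1 i; first exact: reg1.1.
have -> : i = 0 by lia.
by rewrite HF0 -HF1; exact: reg1.1.
Qed.

Lemma x0_multiple_components f :
  (forall i, exists g, pc i f = g * x0) -> exists g, f = g * x0.
Proof.
move=> fx; have [s [_ _ fE]] := comp_support Rdec f.
rewrite fE; apply: (big_ind (fun f => exists g, f = g * x0)).
- by exists 0; rewrite mul0r.
- by move=> _ _ [g ->] [g' ->]; exists (g + g'); rewrite mulrDl.
- by move=> i _; exact: fx.
Qed.

(** Components of degree at least 2 are divisible by [x_0]. A nonzero constant term of [f] would,
    after multiplication by some [h] of degree 1, put [h] into [K x_0]; conversely [m l] starts in
    degree 2. *)
Lemma socle_regularity1 f :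
  (forall m, irrelevant_ideal R m -> exists g, m * f = g * x0) <->
  exists l g, R_ 1 l /\ f = l + g * x0.
Proof.
have deg2 i y : 2 <= i -> exists g, pc i y = g * x0.
  move=> i2; have [||g _ gE] := x0_surjective x0_deg x0_nzd has_dim_HF reg1
    (i := i - 1) (f := pc i y); last by exists g.
  - by lia.
  - by rewrite subrK; exact: comp_deg.
split=> [fm|[l [g [l1 ->]]] m mI].
- have [h h1 hx0] := exists_deg1.
  have [c cE] := R0_scalar (comp_deg Rdec 0 f); rewrite -/(pc 0 f) in cE.
  have [g gE] := fm h (irrelevant_deg (lexx _) h1).
  have := congr1 (pc 1) gE.
  rewrite (pc_mull_homog _ _ h1) /pc (compMr Rdec RB RM _ _ x0_deg) subrr -/(pc 0 f) cE.
  have [c' ->] := R0_scalar (comp_deg Rdec 0 g) => chE.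
  have c0 : c = 0.
    apply/eqP/negPn/negP => c0; apply: (hx0 (c^-1 * c')).
    rewrite rmorphM -mulrA -chE mulrCA -rmorphM mulVf // rmorph1 mulr1 //.
  have [i|g' g'E] := @x0_multiple_components (f - pc 1 f).
    have [i2|i2] := leP 2 i; first exact: deg2.
    exists 0; rewrite mul0r /pc compB ?(comp_homog Rdec RB _ (comp_deg Rdec 1 f));
      last exact: RB.
    have [i0|i0|->] := ltgtP i 0.
    + by rewrite (R_neg i0 (comp_deg _ _ _)) sub0r; case: eqP => [iE|_];
        [move: i0; rewrite iE|rewrite oppr0].
    + have -> : i = 1 by lia.
      by rewrite eqxx subrr.
    + by rewrite -/(pc 0 f) cE c0 rmorph0 subr0.
  exists (pc 1 f), g'; split; first exact: comp_deg.
  by rewrite -g'E addrC subrK.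
- have [i|g' g'E] := @x0_multiple_components (m * l).
    have [i2|i2] := leP 2 i; first exact: deg2.
    exists 0; rewrite mul0r /pc (compMr Rdec RB RM _ _ l1) -/(pc _ m).
    by rewrite (irrelevant_pc _ mI) ?mul0r //; lia.
  by exists (g' + m * g); rewrite mulrDr g'E mulrA mulrDl.
Qed.

Lemma exists_trace_one : exists2 b, Q_ 0 b & sigma b = 1.
Proof.
apply: contrapT => nex.
suff /eqP : 1 = 0 :> Q.
  rewrite -(rmorph1 Qinj) -(rmorph0 Qinj) => /eqP/(Qinj_inj x0_nzd)/eqP.
  by rewrite oner_eq0.
apply: (sigma_nondegenerate_deg x0_deg x0_nzd trace_sigma (i := 0)) => q q0.
rewrite mul1r (tauE x0_deg x0_nzd R_neg trace_sigma q0).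
have [->|t0] := eqVneq (tau q) 0.
  exact: rmorph0.
case: nex; exists (Qscalar ((tau q)^-1) * q).
  by rewrite -[0]addr0; apply: QM => //; exact: Q_scalar.
rewrite (sigmaM trace_sigma _ (L0_scalar x0 _)).
rewrite (tauE x0_deg x0_nzd R_neg trace_sigma q0) -rmorphM mulVf //.
exact: rmorph1.
Qed.

(** [exists_unit] is applied to [ker tau] in [A]. A proper ideal containing this hyperplane would
    equal it and vanish by nondegeneracy, so [A] would be [K], whereas [h / x_0] is not a scalar. *)
Lemma exists_traceless_unit : exists a z, [/\ Q_ 0 a, Q_ 0 z, a * z = 1 & sigma a = 0].
Proof.
have [h h1 hx0] := exists_deg1.
pose H : set Q := [set q | Q_ 0 q /\ sigma q = 0].
have sH : subspace Qscalar H.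
  have [Q00 QL] := Q_subspace x0_deg x0_nzd 0.
  split=> [|c x y [x_0 sx] [y_0 sy]]; first by split=> //; exact: sigma0.
  split; first exact: QL.
  by rewrite (sigmaL trace_sigma _ _ (L0_scalar x0 c)) sx sy mulr0 addr0.
have [||||u [u0 su] [z z0 uz]] := exists_unit (Q_scalar x0) _ _
  (has_dim_Q0 x0_deg x0_nzd has_dim_HF reg1) infK sH _ _.
- by move=> x y; exact: QD.
- by move=> x y x_0 y_0; rewrite -[0]addr0; exact: QM.
- by move=> q [].
- move=> M ML M1 HM; have M0 : M 0 by exact/HM/sH.1.
  have Q01 : Q_ 0 1 by rewrite -(rmorph1 Qscalar); exact: Q_scalar.
  have MZ c q : M q -> M (Qscalar c * q).
    by move=> Mq; rewrite -[_ * _]addr0; apply: ML => //; exact: Q_scalar.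
  have MB x y : M x -> M y -> M (y - x).
    move=> Mx My; rewrite addrC -mulN1r -(rmorphN1 Qscalar); apply: ML => //.
    exact: Q_scalar.
  have t1 : tau 1 != 0.
    apply/eqP => t1; apply: M1; apply: HM; split=> //.
    by rewrite (tauE x0_deg x0_nzd R_neg trace_sigma Q01) t1 rmorph0.
  have MH q : Q_ 0 q -> M (Qscalar (tau 1) * q - Qscalar (tau q)).
    move=> q0; apply: HM; rewrite -[Qscalar (tau q)]mulr1; split.
      apply: QB => //; first by rewrite -[0]addr0; apply: QM => //; exact: Q_scalar.
      by rewrite -[0]addr0; apply: QM => //; exact: Q_scalar.
    rewrite (sigmaB trace_sigma) !(sigmaM trace_sigma _ (L0_scalar x0 _)).
    rewrite (tauE x0_deg x0_nzd R_neg trace_sigma q0).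
    by rewrite (tauE x0_deg x0_nzd R_neg trace_sigma Q01) mulrC subrr.
  (* [tau q] differs from [(tau 1) q] by a traceless element, hence by an element of [M]; were it
     nonzero, [M] would contain 1. *)
  have Msigma q : Q_ 0 q -> M q -> sigma q = 0.
    move=> q0 Mq; rewrite (tauE x0_deg x0_nzd R_neg trace_sigma q0).
    suff -> : tau q = 0 by exact: rmorph0.
    apply/eqP/negPn/negP => tq; apply: M1.
    have -> : 1 = Qscalar ((tau q)^-1) * (Qscalar (tau 1) * q -
        (Qscalar (tau 1) * q - Qscalar (tau q))).
      by rewrite opprB addrC subrK -rmorphM mulVf // rmorph1.
    by apply: (MZ); apply: MB; [exact: MH|exact: MZ].
  have Meq0 q : Q_ 0 q -> M q -> q = 0.
    move=> q0 Mq.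
    apply: (sigma_nondegenerate_deg x0_deg x0_nzd trace_sigma (i := 0)) => p p0.
    apply: Msigma; first by rewrite -[0]addr0; exact: QM.
    by rewrite mulrC -[_ * _]addr0; exact: ML.
  pose q := xpow (- 1) * Qinj h.
  have q0 : Q_ 0 q.
    by rewrite -(addNr 1); apply: QM; [exact: xpow_deg|exact: Q_inj].
  have /eqP : Qscalar (tau 1) * q - Qscalar (tau q) = 0.
    apply: Meq0; last exact: MH.
    apply: QB => //; last exact: Q_scalar.
    by rewrite -[0]addr0; apply: QM => //; exact: Q_scalar.
  rewrite subr_eq0 => /eqP qE; apply: (hx0 ((tau 1)^-1 * tau q)).
  apply: (Qinj_inj x0_nzd).
  transitivity (Qscalar ((tau 1)^-1 * tau q) * Qinj x0); last exact/esym/rmorphM.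
  rewrite rmorphM -qE mulrA -rmorphM mulVf // rmorph1 mul1r.
  by rewrite -[LHS](xpowK x0_nzd 1) mulrC.
by exists u, z.
Qed.

Local Notation CXP := (CXP x0_deg x0_nzd R_neg trace_sigma).

Lemma pc0M (f g : R) : pc 0 (f * g) = pc 0 f * pc 0 g.
Proof.
have [t [ut t0 tE]] := compM Rdec RB RM 0 f g; rewrite [LHS]tE.
have z j : j \in t -> j != 0 -> hcomp Rdec (0 - j) f * hcomp Rdec j g = 0.
  move=> _ j0; have [jn|jp|jE] := ltgtP j 0; last by rewrite jE eqxx in j0.
    by rewrite (R_neg jn (comp_deg Rdec j g)) mulr0.
  by rewrite (R_neg _ (comp_deg Rdec (0 - j) f)) ?mul0r // sub0r oppr_lt0.
have [zt|zt] := boolP (0 \in t).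
  rewrite (big_rem _ zt) /= big_seq big1 ?addr0 ?subr0 // => j.
  by rewrite mem_rem_uniq // !inE => /andP[j0 jt]; exact: z.
rewrite big_seq big1 => [|j jt]; first by rewrite [pc 0 g]/pc t0 ?mulr0.
by apply: z => //; apply: contra zt => /eqP<-.
Qed.

(** For index 1 all of [Qh x0] in degree 1 comes from [R], so the conditions against [R_1] are
    enough for nondegeneracy. *)
Lemma CX_low g j : CX g -> j < -1 -> qc j g = 0.
Proof.
move=> /CXP Cg j1.
apply: (sigma_nondegenerate_deg x0_deg x0_nzd trace_sigma (i := 1)) => q q1.
have [f f1 ->] := Q_Qinj x0_deg x0_nzd has_dim_HF reg1 (lexx _) q1.
by apply: (Cg 1) => //; lia.
Qed.

Lemma CX_sigma g : CX g -> sigma (qc (- 1) g) = 0.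
Proof.
move=> /CXP/(_ 0 (- 1) 1 (ga_deg1 R)); rewrite rmorph1 mulr1; exact.
Qed.

Lemma CX_degN1 g : Q_ (- 1) g -> sigma g = 0 -> CX g.
Proof.
move=> g1 g0; apply/CXP => i j f fi ij.
rewrite (qc_homog x0_deg x0_nzd j g1); case: eqP => [jE|_]; last first.
  by rewrite mul0r (sigma0 trace_sigma).
have [i0|i0|iE] := ltgtP i 0.
- by rewrite (R_neg i0 fi) rmorph0 mulr0 (sigma0 trace_sigma).
- by move: ij; rewrite jE; lia.
rewrite iE in fi; have [c ->] := R0_scalar fi.
by rewrite mulrC (sigmaM trace_sigma _ (L0_scalar x0 c)) g0 mulr0.
Qed.

Lemma CX_deg_ge0 i q : 0 <= i -> Q_ i q -> CX q.
Proof.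
move=> i0 qi; apply/CXP => k j f fk kj.
rewrite (qc_homog x0_deg x0_nzd j qi); case: eqP => [jE|_]; last first.
  by rewrite mul0r (sigma0 trace_sigma).
have k0 : k < 0 by move: kj; rewrite jE; lia.
by rewrite (R_neg k0 fk) rmorph0 mulr0 (sigma0 trace_sigma).
Qed.

(** The lowest possible degrees of the factors are 0 and - 1, so only these components
    contribute. *)
Lemma qcN1_mul (a : R) g : CX g -> qc (- 1) (Qinj a * g) = Qinj (pc 0 a) * qc (- 1) g.
Proof.
move=> Cg; have [t [ut t0 tE]] :=
  compM (Qdec x0_deg x0_nzd) (QB x0_deg) (@QM _ _ _) (- 1) (Qinj a) g.
rewrite [LHS]tE.
have z j : j != - 1 -> qc (- 1 - j) (Qinj a) * qc j g = 0.
  move=> j1; have [jn|jp|jE] := ltgtP j (- 1); last by rewrite jE eqxx in j1.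
    by rewrite (CX_low Cg jn) mulr0.
  rewrite qc_inj; have -> : pc (- 1 - j) a = 0.
    by apply: R_neg (comp_deg Rdec _ a); lia.
  by rewrite rmorph0 mul0r.
have [zt|zt] := boolP (- 1 \in t).
  rewrite (big_rem _ zt) /= big_seq big1 ?addr0 => [|j].
    by rewrite subrr -/(qc 0 (Qinj a)) qc_inj.
  by rewrite mem_rem_uniq // !inE => /andP[j1 _]; exact: z.
rewrite big_seq big1 => [|j jt]; first by rewrite /qc t0 ?mulr0.
by apply: z; apply: contra zt => /eqP<-.
Qed.

Hypothesis rE : regularity_index R = 1.

(* The module C_X / R u is concentrated in degree - 1. It is realized as the  *)
(* complement sigma (w q) = 0 of the line K u in the elements of degree - 1   *)
(* of C_X, on which R acts through R_0.                                       *)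
Lemma almost_gorenstein_regularity1 : almost_gorenstein sigma.
Proof.
have [a [z [a0 z0 az sa]]] := exists_traceless_unit.
have [b b0 sb] := exists_trace_one.
(* [v] is the inverse of [u], and [w] is normalized by [sigma (w u) = sigma b = 1]. *)
pose u := xpow (- 1) * a; pose v := xpow 1 * z; pose w := v * b.
have uv : u * v = 1.
  by rewrite /u /v mulrACA -xpowD // addNr xpow0 mul1r az.
have u_deg : Q_ (- 1) u by rewrite -[X in Q_ X]addr0; apply: QM => //; exact: xpow_deg.
have v_deg : Q_ 1 v by rewrite -[X in Q_ X]addr0; apply: QM => //; exact: xpow_deg.
have w_deg : Q_ 1 w by rewrite -[X in Q_ X]addr0; exact: QM.
have su : sigma u = 0 by rewrite (sigmaM trace_sigma _ (L0_xpow x0 _)) sa mulr0.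
have swu : sigma (w * u) = 1 by rewrite -sb /w mulrC mulrA uv mul1r.
have w0 q : Q_ (- 1) q -> sigma (w * q) = Qscalar (tau (w * q)).
  move=> q1; apply: (tauE x0_deg x0_nzd R_neg trace_sigma).
  by rewrite -(addrN 1); exact: QM.
pose S : set Q := [set q | [/\ Q_ (- 1) q, sigma q = 0 & sigma (w * q) = 0]].
pose act f q : Q := Qinj (pc 0 f) * q.
have pc0_scalar f : exists c, Qinj (pc 0 f) = Qscalar c.
  have [c cE] := R0_scalar (comp_deg Rdec 0 f).
  by exists c; rewrite /pc cE.
have actS f q : S q -> S (act f q).
  move=> [q1 sq swq]; rewrite /act; have [c ->] := pc0_scalar f; split.
  - by rewrite -[X in Q_ X]add0r; apply: QM => //; exact: Q_scalar.
  - by rewrite (sigmaM trace_sigma _ (L0_scalar x0 c)) sq mulr0.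
  - by rewrite mulrCA (sigmaM trace_sigma _ (L0_scalar x0 c)) swq mulr0.
have [||||||C [inc [inc_inj incS incT incZ incD]]] :=
  @exists_submodule R Q S act _ _ actS.
- by split; [exact: Q0|exact: sigma0|rewrite mulr0 (sigma0 trace_sigma)].
- move=> x y [x1 sx swx] [y1 sy swy]; split; first exact: QB.
    by rewrite (sigmaB trace_sigma) sx sy subrr.
  by rewrite mulrBr (sigmaB trace_sigma) swx swy subrr.
- by move=> f g x _; rewrite /act pc0M rmorphM mulrA.
- move=> x _; rewrite /act /pc (comp_homog Rdec RB _ (ga_deg1 R)) eqxx.
  by rewrite rmorph1 mul1r.
- by move=> f x y _ _; rewrite /act mulrDr.
- by move=> f g x _; rewrite /act /pc compD ?rmorphD ?mulrDl //; exact: RB.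
have inc0 : inc 0 = 0 by apply: (addrI (inc 0)); rewrite -incD !addr0.
(* The projection of the component of degree - 1 onto [S] along [u]. *)
pose p q := qc (- 1) q - sigma (w * qc (- 1) q) * u.
have pS q : CX q -> S (p q).
  move=> Cq; have q1 := qc_deg x0_deg x0_nzd (- 1) q.
  rewrite /S /p w0 //; split.
  - apply: QB => //; rewrite -[X in Q_ X]add0r; apply: QM => //; exact: Q_scalar.
  - rewrite (sigmaB trace_sigma) (CX_sigma Cq) sub0r.
    by rewrite (sigmaM trace_sigma _ (L0_scalar x0 _)) su mulr0 oppr0.
  - rewrite mulrBr (sigmaB trace_sigma) w0 // mulrCA.
    by rewrite (sigmaM trace_sigma _ (L0_scalar x0 _)) swu mulr1 subrr.
have /choice[beta betaE] q : exists c, CX q -> inc c = p q.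
  have [Cq|nCq] := pselect (CX q); last by exists 0.
  by have [c cE] := incT _ (pS q Cq); exists c.
have CXMD f g h : CX g -> CX h -> CX (Qinj f * g + h).
  by move=> Cg Ch; exact: (CX_subspace x0_deg x0_nzd R_neg trace_sigma f Cg Ch).
have Cu f : CX (Qinj f * u).
  by apply: (CXM x0_deg x0_nzd R_neg trace_sigma); exact: CX_degN1.
have Cinc c : CX (inc c) by have [c1 sc _] := incS c; exact: CX_degN1.
have p_homog q : Q_ (- 1) q -> p q = q - sigma (w * q) * u.
  by move=> q1; rewrite /p (qc_homog x0_deg x0_nzd _ q1) eqxx.
(* [C] sits in degree 0, because the twist by the index 1 moves degree - 1 there. *)
exists C, (fun i => [set c | i != 0 -> c = 0]), (fun f => Qinj f * u), beta; split.
- split=> [i j f c fi cj|i c d ci di|c] /=.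
  + move=> ij0; apply: inc_inj; rewrite incZ inc0 /act.
    have [j0|/cj ->] := eqVneq j 0; last by rewrite inc0 mulr0.
    rewrite /pc (comp_homog Rdec RB _ fi); case: eqP => [iE|_].
      by rewrite -iE j0 addr0 eqxx in ij0.
    by rewrite rmorph0 mul0r.
  + by move=> i0; rewrite ci // di // subrr.
  + exists (fun i => if i == 0 then c else 0); split.
      split=> [i|]; first by case: eqP.
      exists [:: 0]; split=> // [i|]; last by rewrite big_seq1 eqxx.
      by rewrite inE => /negPf->.
    move=> c' [c'0 [s [us s0 cE]]]; apply/funext => i.
    have [->|i0] := eqVneq i 0; last by rewrite c'0.
    have z' j : j != 0 -> c' j = 0 by exact: c'0.
    rewrite cE; have [zs|zs] := boolP (0 \in s).
      rewrite (big_rem _ zs) /= big_seq big1 ?addr0 // => j.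
      by rewrite mem_rem_uniq // !inE => /andP[j0 _]; exact: z'.
    rewrite s0 // big_seq big1 // => j js; apply: z'.
    by apply: contra zs => /eqP<-.
- split=> [f g h|//|i f fi].
    by rewrite rmorphD rmorphM /=; ring.
  by rewrite rE; apply: QM => //; exact: Q_inj.
- split=> [f g h Cg Ch|i g Cg gi].
    apply: inc_inj; rewrite incD incZ !betaE //; last exact: CXMD.
    rewrite /act /p qcD qcN1_mul // [w * (_ + _)]mulrDr.
    have [c ->] := pc0_scalar f.
    rewrite [w * (_ * _)]mulrCA (sigmaD trace_sigma) (sigmaM trace_sigma _ (L0_scalar x0 c)).
    ring.
  move=> /= i0; apply: inc_inj; rewrite betaE // inc0 /p.
  rewrite (qc_homog x0_deg x0_nzd _ gi); case: eqP => [iE|_].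
    by case/eqP: i0; move: iE; rewrite rE; lia.
  by rewrite mulr0 (sigma0 trace_sigma) mul0r subrr.
- split.
  + move=> f g fg; apply: (Qinj_inj x0_nzd).
    have E h : Qinj h = Qinj h * u * v by rewrite -mulrA uv mulr1.
    by rewrite E [RHS]E fg.
  + move=> g Cg; split=> [bg|[f gE]].
      have /esym/eqP := betaE g Cg; rewrite bg inc0 subr_eq0 => /eqP gE.
      (* [g v] lies in [R]: it vanishes in negative degrees, is a scalar in degree 0 as the
         component of [g] in degree - 1 is in [K u], and [R] is everything in positive degrees. *)
      have [i|f fE] := Qinj_components (x0_deg := x0_deg) (x0_nzd := x0_nzd) (q := g * v).
        rewrite (qcM x0_deg x0_nzd _ _ v_deg).
        have [i0|i0|->] := ltgtP i 0.
        * by exists 0; rewrite CX_low ?mul0r ?rmorph0 //; lia.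
        * have [||f _ fE] := Q_Qinj x0_deg x0_nzd has_dim_HF reg1 (i := i)
            (q := qc (i - 1) g * v).
          - by lia.
          - by have := QM (qc_deg x0_deg x0_nzd (i - 1) g) v_deg; rewrite subrK.
          by exists f.
        * rewrite sub0r gE -mulrA uv mulr1 w0; last exact: qc_deg.
          by exists (ga_scalar R (tau (w * qc (- 1) g))).
      by exists f; rewrite -fE -mulrA [v * u]mulrC uv mulr1.
    apply: inc_inj; rewrite betaE // inc0 gE /p qcN1_mul; last exact: CX_degN1.
    rewrite (qc_homog x0_deg x0_nzd _ u_deg) eqxx; have [c ->] := pc0_scalar f.
    rewrite [w * (_ * _)]mulrCA (sigmaM trace_sigma _ (L0_scalar x0 c)) swu mulr1.
    exact: subrr.
  + move=> c; exists (inc c) => //; apply: inc_inj; rewrite betaE //.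
    by have [c1 _ swc] := incS c; rewrite p_homog // swc mul0r subr0.
- move=> f c fI; apply: inc_inj; rewrite incZ inc0 /act.
  by rewrite (irrelevant_pc _ fI) // rmorph0 mul0r.
Qed.

(** The complementary module starts in degree - 1 and [R] fills [Qh x0] from degree 1 on, so degree
    2 and up is always in the different. Components of degree 0 and 1 are excluded because products
    landing in degree 0 must be scalars. *)
Lemma minimal_different_regularity1 :
  (2 < D)%N -> minimal_dedekind_different sigma.
Proof.
move=> D2; rewrite /minimal_dedekind_different rE.
have [h h1 hx0] := exists_deg1.
have [a [z [a0 z0 az sa]]] := exists_traceless_unit.
pose u := xpow (- 1) * a.
have u_deg : Q_ (- 1) u by rewrite -[X in Q_ X]addr0; apply: QM => //; exact: xpow_deg.
have Cu : CX u.
  by apply: CX_degN1; rewrite // (sigmaM trace_sigma _ (L0_xpow x0 _)) sa mulr0.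
(* With [HF R 0 = 1] the required inequality is [1 + 2 <= deg X]. *)
have [g [Cg g_deg gu]] := exists_CX_off_line x0_deg x0_nzd R_neg trace_sigma u
  (has_dim_Q0 x0_deg x0_nzd has_dim_HF reg1) (has_dim_HF 0) ltac:(by rewrite HF0).
have cancel c p q : c != 0 -> Qscalar c * p = q -> p = Qscalar c^-1 * q.
  by move=> c0 <-; rewrite mulrA -rmorphM mulVf // rmorph1 mul1r.
apply/seteqP; split=> [q qC|_ [f [w fw w0] <-] p Cp].
- have [|f] := qC 1.
    by apply: (CX_deg_ge0 (lexx _)); rewrite -(rmorph1 Qscalar); exact: Q_scalar.
  rewrite mulr1 => qE; subst q.
  have top k p : CX p -> Q_ (- k) p -> exists c, Qinj (pc k f) * p = Qscalar c.
    move=> /qC[y yE] pk; have := congr1 (qc 0) yE.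
    rewrite (qcM x0_deg x0_nzd _ _ pk) sub0r opprK !qc_inj => ->.
    by have [c cE] := R0_scalar (comp_deg Rdec 0 y); exists c; rewrite /pc cE.
  have f0 : pc 0 f = 0.
    have [c cE] := R0_scalar (comp_deg Rdec 0 f); rewrite -/(pc 0 f) in cE.
    rewrite cE; suff -> : c = 0 by exact: rmorph0.
    apply/eqP/negPn/negP => c0.
    have p0 : Q_ 0 (xpow (- 1) * Qinj h).
      by rewrite -(addNr 1); apply: QM; [exact: xpow_deg|exact: Q_inj].
    have [|c'] := top 0 _ (CX_deg_ge0 (lexx _) p0); first by rewrite oppr0.
    rewrite cE -[Qinj (ga_scalar _ _)]/(Qscalar c) => /(cancel _ _ _ c0) pE.
    apply: (hx0 (c^-1 * c')); apply: (Qinj_inj x0_nzd).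
    transitivity (Qscalar (c^-1 * c') * Qinj x0); last exact/esym/rmorphM.
    by rewrite rmorphM -pE -[LHS](xpowK x0_nzd 1) mulrC.
  (* If [f_1 u = c] and [f_1 g = c'] are scalars, then [c g = c' u]; as [g] is off the line [K u],
     this gives [c = 0], and [u] is a unit. *)
  have f1 : pc 1 f = 0.
    have [c cE] := top 1 u Cu u_deg; have [c' c'E] := top 1 g Cg g_deg.
    have [c0|c0] := eqVneq c 0; last first.
      case: (gu (c^-1 * c')); rewrite rmorphM -mulrA; apply: cancel => //.
      by rewrite -c'E -cE; ring.
    apply: (Qinj_inj x0_nzd); rewrite rmorph0.
    have -> : Qinj (pc 1 f) = xpow 1 * z * (Qinj (pc 1 f) * u).
      have -> : xpow 1 * z * (Qinj (pc 1 f) * u) =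
        (xpow 1 * xpow (- 1)) * (a * z) * Qinj (pc 1 f) by rewrite /u; ring.
      by rewrite -xpowD // addrN xpow0 az !mul1r.
    by rewrite cE c0 rmorph0 mulr0.
  exists f => //; exists (fun i => pc i f); first exact: comp_decomposition.
  move=> i; have [i0 _|i0 i2|-> //] := ltgtP i 0.
    exact: R_neg i0 (comp_deg Rdec i f).
  by have -> : i = 1 by lia.
- have f0 i : i < 2 -> pc i f = 0 by move=> i2; rewrite /pc (comp_uniq Rdec fw) w0.
  apply: (Qinj_components (x0_deg := x0_deg) (x0_nzd := x0_nzd)) => i.
  have [i1|i1] := leP 1 i.
    have [y _ yE] := Q_Qinj x0_deg x0_nzd has_dim_HF reg1 i1
      (qc_deg x0_deg x0_nzd i (Qinj f * p)).
    by exists y.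
  exists 0; rewrite rmorph0.
  have [t [_ _ tE]] :=
    compM (Qdec x0_deg x0_nzd) (QB x0_deg) (@QM _ _ _) i (Qinj f) p.
  rewrite [LHS]tE big1 // => j _.
  have [j1|j1] := ltP j (- 1); first by rewrite [hcomp _ j p](CX_low Cp j1) mulr0.
  rewrite [hcomp _ (i - j) _](qc_inj x0_deg x0_nzd) f0 ?rmorph0 ?mul0r //; lia.
Qed.

End RegularityOne.

(** * Level schemes *)

Section Level.
Variables (K : fieldType) (n : nat) (X : zero_scheme K n).
Local Notation R := (coord_ring X).
Local Notation x0 := (coord_x0 X).
Local Notation Rbar := {ideal_quot (Idealr.clone R (@x0_ideal K n X) _)}.

Lemma pi_Rbar_eq0 (f : R) : \pi_Rbar f = 0 <-> exists g, f = g * x0.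
Proof.
have E : (f \in Idealr.clone R (@x0_ideal K n X) _) <-> exists g, f = g * x0.
  by split=> /asboolP.
rewrite -E -[f in X in _ <-> X]subr0 Quotient.idealrBE; split=> [H|/eqP->].
  by apply/eqP; rewrite [LHS]H; symmetry; exact: rmorph0.
exact: rmorph0.
Qed.

Lemma socle_RbarP (f : R) : socle_Rbar (\pi_Rbar f) <->
  forall m, irrelevant_ideal R m -> exists g, m * f = g * x0.
Proof.
by split=> H m /H; rewrite -rmorphM => /pi_Rbar_eq0.
Qed.

End Level.

(** * The three claims for the coordinate ring *)

Theorem proposition6p11 (K : fieldType) (n : nat) (X : zero_scheme K n)
    (infinite_K : infinite_set [set: K])
    (x0_Supp : forall p, Proj (coord_ring X) p -> ~ p (coord_x0 X))
    (gorenstein_X : locally_gorenstein (coord_ring X))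
    (sigma : Qh (coord_x0 X) -> Qh (coord_x0 X))
    (trace_sigma : trace_map sigma) :
  [/\ regularity_index (coord_ring X) = 1 ->
        almost_gorenstein sigma /\ level X,
      regularity_index (coord_ring X) = 1 ->
        (2 < proj_degree (coord_ring X))%N ->
        minimal_dedekind_different sigma
    & level X ->
        2 <= Num.min (Delta (coord_ring X)) (regularity_index (coord_ring X)) ->
        ~ almost_gorenstein sigma].
Proof.
have x0_deg := coord_x0_deg X; have x0_nzd := coord_x0_nonzerodivisor x0_Supp.
have R_neg := @coord_degN K n X; have R0_scalar := @coord_deg0_scalar K n X.
have HFP := has_dim_HF X; have HF_0 := HF0 X.
(* The default value of [regularity_index] is 0, so a nonzero value is a genuine index. *)
have reg : regularity_index (coord_ring X) != 0 ->
    is_regularity_index (coord_ring X) (regularity_index (coord_ring X)).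
  rewrite /regularity_index; case: xgetP => [r _ //|_]; by rewrite eqxx.
split.
- move=> r1; have reg1 : is_regularity_index (coord_ring X) 1%N%:Z.
    by have := reg; rewrite r1; apply.
  split; first exact: (almost_gorenstein_regularity1 x0_deg x0_nzd).
  rewrite /level r1; apply/seteqP; split=> [y|_ [f f1 <-]].
    rewrite -[y]reprK => /socle_RbarP.
    move=> /(socle_regularity1 x0_deg x0_nzd R_neg R0_scalar HFP HF_0 reg1).
    move=> [l [g [l1 fE]]]; exists l => //; apply/eqP; rewrite eq_sym -subr_eq0.
    rewrite -rmorphB; apply/eqP/pi_Rbar_eq0; exists g.
    by rewrite fE addrC addKr.
  apply/socle_RbarP.
  apply/(socle_regularity1 x0_deg x0_nzd R_neg R0_scalar HFP HF_0 reg1).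
  by exists f, 0; split=> //; rewrite mul0r addr0.
- move=> r1; have reg1 : is_regularity_index (coord_ring X) 1%N%:Z.
    by have := reg; rewrite r1; apply.
  exact: (minimal_different_regularity1 x0_deg x0_nzd).
- move=> lev; rewrite le_min => /andP[Delta2 r2] aG.
  have [r rE] : exists r : nat, regularity_index (coord_ring X) = r.+1%:Z.
    by move: r2; case: (regularity_index _) => // -[|r] // _; exists r.
  have regr : is_regularity_index (coord_ring X) r.+1%:Z.
    by rewrite -rE; apply: reg; rewrite rE.
  have rD : (HF (coord_ring X) r + 2 <= proj_degree (coord_ring X))%N.
    move: Delta2; rewrite /Delta rE (_ : r.+1%:Z - 1 = r); last by lia.
    by lia.
  have [l [l1 lx lm]] := almost_gorenstein_socle x0_deg x0_nzd R_neg HFP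
    trace_sigma rE regr rD aG.
  (* Levelness makes [l] congruent modulo [x_0] to an element of degree at least 2; in degree 1 this
     leaves [l] in [K x_0], which is excluded. *)
  have /socle_RbarP := lm; rewrite lev => -[f fr /eqP].
  rewrite eq_sym -subr_eq0 -rmorphB => /eqP/pi_Rbar_eq0[g gE].
  have := congr1 (pc 1) gE.
  rewrite /pc (compMr (@ga_decomposition _ _) (@ga_degB _ _) (@ga_degM _ _) _ _ x0_deg).
  rewrite subrr compB; last exact: ga_degB.
  rewrite (comp_homog _ (@ga_degB _ _) _ l1) (comp_homog _ (@ga_degB _ _) _ fr) eqxx.
  case: eqP => [rE1|_]; first by move: r2; rewrite -rE1.
  rewrite subr0; have [c ->] := R0_scalar _ (comp_deg (@ga_decomposition _ _) 0 g).
  exact: lx.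
Qed.
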